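(* Let $N\ge 1$ and let $\alpha=(N;\mathbf{A},\mathbf{B},\mathbf{C},\mathbf{D};\mathcal{X},\mathcal{U},\mathcal{Y})$ be an arbitrary multiparametric discrete time-invariant linear system. Then there exist a separable Hilbert space $\widetilde{\mathcal{X}}$, a system $\widetilde{\alpha}=(N;\widetilde{\mathbf{A}},\widetilde{\mathbf{B}},\widetilde{\mathbf{C}},\mathbf{D};\widetilde{\mathcal{X}},\mathcal{U},\mathcal{Y})$ (with the same $\mathbf{D}$, $\mathcal{U}$, $\mathcal{Y}$), and a canonical symmetry $J\in L(\widetilde{\mathcal{X}})$ such that $\widetilde{\alpha}$ is a dilation of $\alpha$ and $\widetilde{\alpha}$ is a multiparametric $J$-conservative scattering linear system.
   Context: All Hilbert spaces are complex and separable; $L(\mathcal{H}_1,\mathcal{H}_2)$ denotes the Banach space of bounded linear operators from $\mathcal{H}_1$ to $\mathcal{H}_2$, and $L(\mathcal{H}):=L(\mathcal{H},\mathcal{H})$. For $z=(z_1,\ldots,z_N)\in\mathbb{C}^N$ and an $N$-tuple of operators $\mathbf{T}=(T_1,\ldots,T_N)$, write $z\mathbf{T}:=\sum_{k=1}^N z_kT_k$. A multiparametric discrete time-invariant linear system $\alpha=(N;\mathbf{A},\mathbf{B},\mathbf{C},\mathbf{D};\mathcal{X},\mathcal{U},\mathcal{Y})$ consists of separable Hilbert spaces $\mathcal{X}$ (states), $\mathcal{U}$ (inputs), $\mathcal{Y}$ (outputs) and $N$-tuples of bounded linear operators $\mathbf{A}=(A_k)$, $\mathbf{B}=(B_k)$,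 $\mathbf{C}=(C_k)$, $\mathbf{D}=(D_k)$, $k=1,\ldots,N$, with $A_k:\mathcal{X}\to\mathcal{X}$, $B_k:\mathcal{U}\to\mathcal{X}$, $C_k:\mathcal{X}\to\mathcal{Y}$, $D_k:\mathcal{U}\to\mathcal{Y}$; it represents the equations $x(t)=\sum_{k=1}^N(A_kx(t-e_k)+B_ku(t-e_k))$, $y(t)=\sum_{k=1}^N(C_kx(t-e_k)+D_ku(t-e_k))$ for $t\in\mathbb{Z}^N$, $|t|:=\sum_k t_k>0$, where $e_k$ is the $k$-th standard basis vector of $\mathbb{Z}^N$. Its system operators are $G_k=\begin{pmatrix}A_k&B_k\\ C_k&D_k\end{pmatrix}:\mathcal{X}\oplus\mathcal{U}\to\mathcal{X}\oplus\mathcal{Y}$, and $\mathbf{G}=(G_1,\ldots,G_N)$. Dilation: a system $\widetilde{\alpha}=(N;\widetilde{\mathbf{A}},\widetilde{\mathbf{B}},\widetilde{\mathbf{C}},\mathbf{D};\widetilde{\mathcal{X}},\mathcal{U},\mathcal{Y})$ is a dilation of $\alpha=(N;\mathbf{A},\mathbf{B},\mathbf{C},\mathbf{D};\mathcal{X},\mathcal{U},\mathcal{Y})$ if $\widetilde{\mathcal{X}}\supset\mathcal{X}$ (as a closed subspace) and for each $z\in\mathbb{C}^N$ there exist subspaces (closed) $\mathcal{D}_z$ and $\mathcal{D}_{*,z}$ of $\widetilde{\mathcal{X}}$ such that $\widetilde{\mathcal{X}}=\mathcal{D}_z\oplus\mathcal{X}\oplus\mathcal{D}_{*,z}$ (orthogonal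 sum), $z\widetilde{\mathbf{A}}\mathcal{D}_z\subset\mathcal{D}_z$, $z\widetilde{\mathbf{C}}\mathcal{D}_z=\{0\}$, $(z\widetilde{\mathbf{A}})^*\mathcal{D}_{*,z}\subset\mathcal{D}_{*,z}$, $(z\widetilde{\mathbf{B}})^*\mathcal{D}_{*,z}=\{0\}$, and $z\mathbf{A}=P_{\mathcal{X}}(z\widetilde{\mathbf{A}})|\mathcal{X}$, $z\mathbf{B}=P_{\mathcal{X}}(z\widetilde{\mathbf{B}})$, $z\mathbf{C}=(z\widetilde{\mathbf{C}})|\mathcal{X}$, where $P_{\mathcal{X}}$ is the orthogonal projector of $\widetilde{\mathcal{X}}$ onto $\mathcal{X}$. Canonical symmetry: an operator $J\in L(\mathcal{H})$ on a Hilbert space $\mathcal{H}$ with $J=J^*=J^{-1}$. $J$-conservativity: given a system $\alpha=(N;\mathbf{A},\mathbf{B},\mathbf{C},\mathbf{D};\mathcal{X},\mathcal{U},\mathcal{Y})$ and a canonical symmetry $J\in L(\mathcal{X})$, set $J_1:=J\oplus I_{\mathcal{U}}\in L(\mathcal{X}\oplus\mathcal{U})$ and $J_2:=J\oplus I_{\mathcal{Y}}\in L(\mathcal{X}\oplus\mathcal{Y})$. The system $\alpha$ is a multiparametric $J$-conservative scattering linear system if for every $\zeta\in\mathbb{T}^N:=\{\zeta\in\mathbb{C}^N:|\zeta_k|=1,\ k=1,\ldots,N\}$ one has $(\zeta\mathbf{G})^*J_2(\zeta\mathbf{G})=J_1$ and $(\zeta\mathbf{G})J_1(\zeta\mathbf{G})^*=J_2$.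 *)

(* Defs.v *)
From HB Require Import structures.
From mathcomp Require Import all_boot all_order all_algebra.
From mathcomp Require Import all_classical all_reals all_analysis.
From mathcomp Require Import complex ring.

Set Implicit Arguments.
Unset Strict Implicit.
Unset Printing Implicit Defensive.

Import Order.TTheory GRing.Theory Num.Def Num.Theory.
Import numFieldNormedType.Exports.

Local Open Scope classical_set_scope.
Local Open Scope ring_scope.

(* The inner product is linear in its first argument and conjugate-linear in
   its second one. *)
HB.mixin Record CompleteNormedModule_isSepHilbert (R : realType) V
    & CompleteNormedModule R[i] V := {
  hdot : {dot V for @conjC R[i]} ;
  sqr_normE : forall x : V, `|x| ^+ 2 = hdot x x ;
  hilbert_separable : exists2 S : set V, countable S & dense S
}.

#[short(type="sepHilbertType")]
HB.structure Definition SepHilbert (R : realType) :=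
  {V of CompleteNormedModule R[i] V & CompleteNormedModule_isSepHilbert R V}.

HB.mixin Record isBoundedOp (K : numFieldType) (V W : normedModType K)
    (f : V -> W) := {
  bounded_op : exists M : K, forall x : V, `|f x| <= M * `|x|
}.

HB.structure Definition BoundedOp (K : numFieldType) (V W : normedModType K) :=
  {f of @GRing.Linear K V W *:%R f & isBoundedOp K V W f}.

Notation "{ 'bounded' V '->' W }" := (@BoundedOp.type _ V%type W%type)
  (at level 0, V at level 98, W at level 99,
   format "{ 'bounded'  V  ->  W }") : type_scope.

(* Orthogonal sum.  The alias is needed because the library endows V * W with
   the sup norm. *)
Definition hsum (R : realType) (V W : sepHilbertType R) : Type := (V * W)%type.

Section HilbertSum.
Variables (R : realType) (V W : sepHilbertType R).
Local Notation E := (hsum V W).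

HB.instance Definition _ := GRing.Lmodule.copy E (V * W)%type.

Definition hsum_norm (u : E) : R[i] := sqrtC (`|u.1| ^+ 2 + `|u.2| ^+ 2).

Let sq_ge0 (u : E) : 0 <= `|u.1| ^+ 2 + `|u.2| ^+ 2.
Proof. by rewrite addr_ge0 ?exprn_ge0. Qed.

Let hsum_norm_sq u : hsum_norm u ^+ 2 = `|u.1| ^+ 2 + `|u.2| ^+ 2.
Proof. by rewrite sqrtCK. Qed.

Let hsum_norm_ge0 u : 0 <= hsum_norm u.
Proof. by rewrite sqrtC_ge0. Qed.

Let minkowski2 (a b c d : R[i]) : 0 <= a -> 0 <= b -> 0 <= c -> 0 <= d ->
  sqrtC ((a + b) ^+ 2 + (c + d) ^+ 2) <=
  sqrtC (a ^+ 2 + c ^+ 2) + sqrtC (b ^+ 2 + d ^+ 2).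
Proof.
move=> a0 b0 c0 d0.
have ac0 : 0 <= a ^+ 2 + c ^+ 2 by rewrite addr_ge0 ?exprn_ge0.
have bd0 : 0 <= b ^+ 2 + d ^+ 2 by rewrite addr_ge0 ?exprn_ge0.
have abcd0 : 0 <= (a + b) ^+ 2 + (c + d) ^+ 2.
  by rewrite addr_ge0 ?exprn_ge0 ?addr_ge0.
have CS : a * b + c * d <= sqrtC (a ^+ 2 + c ^+ 2) * sqrtC (b ^+ 2 + d ^+ 2).
  rewrite -[leLHS]sqrCK ?addr_ge0 ?mulr_ge0// -sqrtCM ?nnegrE//.
  rewrite ler_sqrtC ?nnegrE ?exprn_ge0 ?addr_ge0 ?mulr_ge0 ?exprn_ge0//.
  rewrite -subr_ge0.
  rewrite (_ : _ - _ = (a * d - c * b) ^+ 2); last by ring.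
  by rewrite real_exprn_even_ge0// realB// ger0_real// mulr_ge0.
rewrite -ler_sqr ?nnegrE ?addr_ge0 ?sqrtC_ge0// [leRHS]sqrrD !sqrtCK.
rewrite -subr_ge0.
set p := sqrtC _; set q := sqrtC _.
rewrite (_ : _ - _ = (p * q - (a * b + c * d)) *+ 2); last by ring.
by rewrite mulrn_wge0// subr_ge0.
Qed.

Let hsum_normD (x y : E) : hsum_norm (x + y) <= hsum_norm x + hsum_norm y.
Proof.
apply: le_trans (minkowski2 _ _ _ _) => //.
rewrite ler_sqrtC ?nnegrE ?addr_ge0 ?exprn_ge0 ?addr_ge0//.
by apply: lerD; rewrite ler_sqr ?nnegrE ?addr_ge0// ler_normD.
Qed.

Let hsum_normZ (l : R[i]) (x : E) : hsum_norm (l *: x) = `|l| * hsum_norm x.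
Proof.
by rewrite /hsum_norm !normrZ !exprMn -mulrDr sqrtCM ?nnegrE ?exprn_ge0// sqrCK.
Qed.

Let hsum_norm0_eq0 (x : E) : hsum_norm x = 0 -> x = 0.
Proof.
move/eqP; rewrite sqrtC_eq0 paddr_eq0 ?exprn_ge0// !expf_eq0/= !normr_eq0.
by case: x => a b /andP[/eqP/= -> /eqP ->].
Qed.

HB.instance Definition _ :=
  Lmodule_isNormed.Build R[i] E hsum_normD hsum_normZ hsum_norm0_eq0.

Lemma hsum_normE (u : E) : `|u| ^+ 2 = `|u.1| ^+ 2 + `|u.2| ^+ 2.
Proof. exact: hsum_norm_sq. Qed.

Lemma hsum_norm_fst (u : E) : `|u.1| <= `|u|.
Proof. by rewrite -ler_sqr ?nnegrE// hsum_normE lerDl exprn_ge0. Qed.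

Lemma hsum_norm_snd (u : E) : `|u.2| <= `|u|.
Proof. by rewrite -ler_sqr ?nnegrE// hsum_normE lerDr exprn_ge0. Qed.

Lemma hsum_norm_le (u : E) : `|u| <= `|u.1| + `|u.2|.
Proof.
rewrite -ler_sqr ?nnegrE ?addr_ge0// hsum_normE sqrrD lerD2r lerDl.
by rewrite mulrn_wge0 ?mulr_ge0.
Qed.

Let hsum_complete (F : set_system E) : ProperFilter F -> cauchy F -> cvg F.
Proof.
move=> FF /cauchy_ballP Fc.
have /cauchy_cvg/cvg_ex[/= p Fp] : cauchy (fst @ F : set_system V).
  apply/cauchy_ballP => e e0; have [[A B]/= [FA FB] AB] := Fc e e0.
  exists (fst @` A, fst @` B) => [|_ /= [[x Ax <-] [y By <-]]].
    by split; [apply: filterS FA|apply: filterS FB] => x ?; exists x.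
  have := AB (x, y) (conj Ax By); rewrite -!ball_normE/=.
  exact/le_lt_trans/(hsum_norm_fst (x - y)).
have /cauchy_cvg/cvg_ex[/= q Fq] : cauchy (snd @ F : set_system W).
  apply/cauchy_ballP => e e0; have [[A B]/= [FA FB] AB] := Fc e e0.
  exists (snd @` A, snd @` B) => [|_ /= [[x Ax <-] [y By <-]]].
    by split; [apply: filterS FA|apply: filterS FB] => x ?; exists x.
  have := AB (x, y) (conj Ax By); rewrite -!ball_normE/=.
  exact/le_lt_trans/(hsum_norm_snd (x - y)).
apply/cvg_ex; exists ((p, q) : E); apply/cvgrPdist_lt => e e0.
have e20 : 0 < e / 2 by rewrite divr_gt0.
move/cvgrPdist_lt : Fp => /(_ _ e20) Fp; move/cvgrPdist_lt : Fq => /(_ _ e20) Fq.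
near=> x; apply: (le_lt_trans (hsum_norm_le _)) => /=.
by rewrite [ltRHS]splitr ltrD//; near: x.
Unshelve. all: by end_near. Qed.

HB.instance Definition _ := Uniform_isComplete.Build E hsum_complete.

Definition hsum_dot (u v : E) : R[i] := hdot u.1 v.1 + hdot u.2 v.2.

Let hsum_dot_bilinear :
  bilinear_for ( *%R : GRing.Scale.law _ _) (conjC \; *%R) hsum_dot.
Proof.
split=> [v a x y|v a x y]; rewrite /hsum_dot/=.
  by rewrite !linearPl/= mulrDr addrACA.
by rewrite !linearPr/= mulrDr addrACA.
Qed.

HB.instance Definition _ :=
  bilinear_isBilinear.Build R[i] E E R[i] *%R (conjC \; *%R) hsum_dot
    hsum_dot_bilinear.

Let hsum_dotC (x y : E) :
  hsum_dot x y = (-1) ^+ false * conjC (hsum_dot y x).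
Proof.
rewrite mul1r rmorphD; congr (_ + _).
  by rewrite [LHS]hermC/= mul1r.
by rewrite [LHS]hermC/= mul1r.
Qed.

HB.instance Definition _ :=
  isHermitianSesquilinear.Build R[i] E false conjC hsum_dot hsum_dotC.

Let hsum_dot_normE (u : E) : `|u| ^+ 2 = hsum_dot u u.
Proof. by rewrite hsum_normE !sqr_normE. Qed.

Let hsum_dot_gt0 (u : E) : u != 0 -> 0 < hsum_dot u u.
Proof. by move=> u0; rewrite -hsum_dot_normE exprn_gt0// normr_gt0. Qed.

HB.instance Definition _ := isDotProduct.Build R[i] E hsum_dot hsum_dot_gt0.

Let hsum_separable : exists2 S : set E, countable S & dense S.
Proof.
have [S cS dS] := @hilbert_separable R V; have [T cT dT] := @hilbert_separable R W.
exists (S `*` T); first exact: countableX.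
move=> O [u Ou] oO.
have /nbhs_ballP[e /= e0 ueO] : nbhs u O by exact: open_nbhs_nbhs.
have e20 : 0 < e / 2 by rewrite divr_gt0.
have [|x [ux Sx]] := dS (ball u.1 (e / 2)) _ (ball_open _ _).
  by exists u.1; exact: ballxx.
have [|y [uy Ty]] := dT (ball u.2 (e / 2)) _ (ball_open _ _).
  by exists u.2; exact: ballxx.
exists ((x, y) : E); split => //; apply: ueO.
move: ux uy; rewrite -!ball_normE/= => ux uy.
by apply: (le_lt_trans (hsum_norm_le _)); rewrite [ltRHS]splitr ltrD.
Qed.

HB.instance Definition _ := CompleteNormedModule_isSepHilbert.Build R E
  hsum_dot_normE hsum_separable.

End HilbertSum.

Lemma hdot_hsumE (R : realType) (V W : sepHilbertType R) (u v : hsum V W) :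
  hdot u v = hdot u.1 v.1 + hdot u.2 v.2.
Proof. by []. Qed.

Section Operators.
Variable R : realType.
Implicit Types V W : sepHilbertType R.

(* T^* y is the vector representing x |-> <T x, y>; it exists, by Riesz, for
   every bounded linear T, and it is unique.  *)
Definition hadj V W (T : V -> W) (y : W) : V :=
  xget 0 [set v | forall x, hdot (T x) y = hdot x v].

(* Orthogonal projector onto the closed subspace M. *)
Definition hproj V (M : set V) (x : V) : V :=
  xget 0 [set p | M p /\ forall m, M m -> hdot (x - p) m = 0].

Definition closed_subspace V (M : set V) : Prop :=
  [/\ closed M, M 0 & forall (a : R[i]) u v, M u -> M v -> M (a *: u + v)].

Definition canonical_symmetry V (J : V -> V) : Prop :=
  hadj J = J /\ J \o J = idfun.

Definition hsum_op V V' W W' (S : V -> V') (T : W -> W')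
    (u : hsum V W) : hsum V' W' := (S u.1, T u.2).

Definition pencil N V W (z : 'rV[R[i]]_N) (T : 'I_N -> {bounded V -> W})
  (x : V) : W := \sum_(k < N) z 0 k *: T k x.

End Operators.

Record system (R : realType) (N : nat) (X U Y : sepHilbertType R) := System {
  sysA : 'I_N -> {bounded X -> X} ;
  sysB : 'I_N -> {bounded U -> X} ;
  sysC : 'I_N -> {bounded X -> Y} ;
  sysD : 'I_N -> {bounded U -> Y}
}.

Section BlockOp.
Variables (R : realType) (V W V' W' : sepHilbertType R).
Variables (A : {bounded V -> V'}) (B : {bounded W -> V'}).
Variables (C : {bounded V -> W'}) (D : {bounded W -> W'}).

Definition block_op (u : hsum V W) : hsum V' W' :=
  (A u.1 + B u.2, C u.1 + D u.2).

Let block_op_linear : linear block_op.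
Proof.
by move=> a u v; congr pair; rewrite /= !linearP/= scalerDr addrACA.
Qed.

HB.instance Definition _ := GRing.isLinear.Build R[i] (hsum V W) (hsum V' W')
  *:%R block_op block_op_linear.

Let block_op_bounded : exists M : R[i], forall u, `|block_op u| <= M * `|u|.
Proof.
have bnd (E F : sepHilbertType R) (T : {bounded E -> F}) :
    exists2 M : R[i], 0 <= M & forall x, `|T x| <= M * `|x|.
  have [M TM] := bounded_op (s := T); exists `|M| => // x.
  have /ger0_norm Mx := le_trans (normr_ge0 _) (TM x).
  by rewrite (le_trans (TM x))// -Mx normrM normr_id.
have [MA MA0 HA] := bnd _ _ A; have [MB MB0 HB] := bnd _ _ B.
have [MC MC0 HC] := bnd _ _ C; have [MD MD0 HD] := bnd _ _ D.
exists (MA + MB + (MC + MD)) => u; apply: (le_trans (hsum_norm_le _)) => /=.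
rewrite 3!mulrDl; apply: lerD; apply: (le_trans (ler_normD _ _)); apply: lerD.
- by rewrite (le_trans (HA _))// ler_wpM2l// hsum_norm_fst.
- by rewrite (le_trans (HB _))// ler_wpM2l// hsum_norm_snd.
- by rewrite (le_trans (HC _))// ler_wpM2l// hsum_norm_fst.
- by rewrite (le_trans (HD _))// ler_wpM2l// hsum_norm_snd.
Qed.

HB.instance Definition _ :=
  isBoundedOp.Build R[i] (hsum V W) (hsum V' W') block_op block_op_bounded.

End BlockOp.

Definition sysG (R : realType) N (X U Y : sepHilbertType R)
    (a : system N X U Y) (k : 'I_N) : {bounded hsum X U -> hsum X Y} :=
  block_op (sysA a k) (sysB a k) (sysC a k) (sysD a k).

Definition orthogonal_decomposition (R : realType) (V : sepHilbertType R)
    (M1 M2 M3 : set V) : Prop :=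
  [/\ forall u v, M1 u -> M2 v -> hdot u v = 0,
      forall u v, M1 u -> M3 v -> hdot u v = 0,
      forall u v, M2 u -> M3 v -> hdot u v = 0 &
      forall w, exists u1 u2 u3, [/\ M1 u1, M2 u2, M3 u3 & w = u1 + u2 + u3]].

(* "Xt contains X as a closed subspace" is rendered by a linear isometry
   iota : X -> Xt, which identifies X with the closed subspace range iota. *)
Definition is_dilation (R : realType) N (X Xt U Y : sepHilbertType R)
    (alphat : system N Xt U Y) (alpha : system N X U Y) : Prop :=
  exists iota : {bounded X -> Xt},
  [/\ forall x y, hdot (iota x) (iota y) = hdot x y,
      sysD alphat = sysD alpha &
      forall z : 'rV[R[i]]_N,
        let zAt := pencil z (sysA alphat) in
        let zBt := pencil z (sysB alphat) in
        let zCt := pencil z (sysC alphat) in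
        let P := hproj (range iota) in
        exists Dz Dsz : set Xt,
        [/\ closed_subspace Dz /\ closed_subspace Dsz,
            orthogonal_decomposition Dz (range iota) Dsz,
            zAt @` Dz `<=` Dz /\ zCt @` Dz = [set 0],
            hadj zAt @` Dsz `<=` Dsz /\ hadj zBt @` Dsz = [set 0] &
            [/\ forall x, iota (pencil z (sysA alpha) x) = P (zAt (iota x)),
                forall u, iota (pencil z (sysB alpha) u) = P (zBt u) &
                forall x, pencil z (sysC alpha) x = zCt (iota x)]]].

Definition J_conservative (R : realType) N (X U Y : sepHilbertType R)
    (J : X -> X) (alpha : system N X U Y) : Prop :=
  let J1 : hsum X U -> hsum X U := hsum_op J idfun in
  let J2 : hsum X Y -> hsum X Y := hsum_op J idfun in
  forall zeta : 'rV[R[i]]_N, (forall k, `|zeta 0 k| = 1) ->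
    let G := pencil zeta (sysG alpha) in
    hadj G \o J2 \o G = J1 /\ G \o J1 \o hadj G = J2.

(* Main.v *)
Require Import Defs.
From HB Require Import structures.
From mathcomp Require Import all_boot all_order all_algebra.
From mathcomp Require Import all_classical all_reals all_analysis.
From mathcomp Require Import complex ring lra.

Set Implicit Arguments.
Unset Strict Implicit.
Unset Printing Implicit Defensive.

Import Order.TTheory GRing.Theory Num.Def Num.Theory.
Import numFieldNormedType.Exports.

Local Open Scope classical_set_scope.
Local Open Scope ring_scope.
Local Open Scope complex_scope.

(** The dilation has an explicit form.  A pencil sum_k z_k G_k that is
    J-unitary on the whole torus is a composite V Z(z) W of two J-unitary
    operators V, W with the operator Z(z) that multiplies by z_k the k-th piece
    of an orthogonal decomposition of a Krein space, and conversely every such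
    composite is J-unitary on the torus; so the dilation is sought as such a
    composite.

    Write H = X + U, H' = X + Y (orthogonal sums) and let G(z) : H -> H' be the
    pencil of system operators.  Put F = l^2(H'), let Z(z) multiply the k-th
    slot of F by z_k, and set Gamma h = (G_k h)_k and Delta h' = (h')_k, with
    zeros in the slots without index.  Then Delta^* Z(z) Gamma = G(z).  To make
    Gamma and Delta^* pieces of J-unitary operators, add two copies of F with
    the hyperbolic form <f, g'> + <g, f'>.  Each copy is isotropic, so h |-> (h, 0, Gamma h)
    preserves the form for every bounded Gamma whatsoever, and it extends to the
    J-unitary shear
        (h, f, g) |-> (h - Gamma^* f, f, g + Gamma h - 1/2 Gamma Gamma^* f).
    The shear of Gamma, followed by Z(z), by the exchange of the two copies of F
    and by the inverse shear of Delta, is a pencil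
        H + (H' + F + F) -> H' + (H + F + F)
    that is J-unitary on the torus and has G(z) as its corner H -> H'.  The
    indefinite metric is what replaces the square roots of defect operators of
    the Hilbert space construction.

    The surplus input space H' + F + F is fed by a backward shift on
    D_* = l^2(H' + F + F), and the surplus output space H + F + F is absorbed
    by a forward shift on D = l^2(H + F + F).  With state space D + X + D_* this
    is the required dilation, with the same D and D_* for all z.

    J-conservativity is checked without computing any adjoint of the dilation:
    an operator that is onto and preserves the indefinite forms satisfies both
    of its identities (krein_unitary_hadj).  The remaining work is the Riesz
    representation theorem (Riesz), which provides Gamma^* and Delta^*, and the
    construction of l^2(E) as a separable Hilbert space. *)

(** * Inner products and Cauchy-Schwarz *)

Lemma ReC (R : realType) (z : R[i]) : complex.Re (conjC z) = complex.Re z.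
Proof. by case: z. Qed.

Lemma discriminant_le (R : realType) (a b e : R) : 0 <= a ->
  (forall t, 0 <= e + 2 * t * b + t ^+ 2 * a) -> b ^+ 2 <= e * a.
Proof.
rewrite le_eqVlt => /predU1P[<- H|a0 H].
  have [->|b0] := eqVneq b 0; first by rewrite expr0n/= mulr0.
  have := H (- (e + 1) / (2 * b)).
  rewrite (_ : _ + _ = -1) ?lerN10//; first by rewrite ler0N1.
  by field.
have := H (- b / a); rewrite -(pmulr_lge0 _ a0).
rewrite (_ : (_ + _) * a = e * a - b ^+ 2); first by rewrite subr_ge0.
by field; rewrite gt_eqF.
Qed.

(** The facts below are stated for an inner product on a bare module because
    the norm of l^2 is obtained from them, before there is a normed space. *)
Section InnerProduct.
Variables (R : realType) (V : lmodType R[i]) (f : {dot V for @conjC R[i]}).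
Implicit Types (u v w : V) (z : R[i]).

Definition nsq u : R := complex.Re (f u u).

Lemma nsqE u : (nsq u)%:C = f u u.
Proof. by rewrite RRe_real// ger0_real// dnorm_ge0. Qed.

Lemma nsq_ge0 u : 0 <= nsq u.
Proof. by rewrite -ler0c nsqE dnorm_ge0. Qed.
Hint Resolve nsq_ge0 : core.

Lemma nsq_eq0 u : (nsq u == 0) = (u == 0).
Proof. by rewrite -(dnorm_eq0 f) -nsqE -(inj_eq (@complexI R)). Qed.

Lemma nsqZ z u : nsq (z *: u) = complex.Re (`|z| ^+ 2) * nsq u.
Proof. by rewrite /nsq dnormZ -nsqE -add_Re2_Im2 -rmorphM. Qed.

Lemma nsqN u : nsq (- u) = nsq u.
Proof. by rewrite /nsq hnormN. Qed.

Lemma nsqD u v : nsq (u + v) = nsq u + nsq v + 2 * complex.Re (f u v).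
Proof. by rewrite /nsq dnormD !raddfD/= ReC mulr2n mulrDl mul1r. Qed.

Lemma nsqB u v : nsq (u - v) = nsq u + nsq v - 2 * complex.Re (f u v).
Proof. by rewrite nsqD nsqN linearNr raddfN mulrN. Qed.

Lemma dotC u v : f v u = conjC (f u v).
Proof. by rewrite hermC expr0 mul1r. Qed.

Lemma Re_dotZr (t : R) u v : complex.Re (f u (t%:C *: v)) = t * complex.Re (f u v).
Proof.
rewrite linearZr_LR/= (_ : conjC t%:C = t%:C); last exact: conjc_real.
by case: (f u v) => a b /=; rewrite mul0r subr0.
Qed.

Lemma CauchySchwarz_Re u v : complex.Re (f u v) ^+ 2 <= nsq u * nsq v.
Proof.
apply: discriminant_le => // t.
rewrite (_ : _ + _ = nsq (u + t%:C *: v)) // nsqD nsqZ Re_dotZr.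
by rewrite -add_Re2_Im2/= expr0n addr0 mulrA [RHS]addrAC.
Qed.

Lemma sqrt_nsqD u v : Num.sqrt (nsq (u + v)) <= Num.sqrt (nsq u) + Num.sqrt (nsq v).
Proof.
rewrite -(ler_pXn2r (ltn0Sn 1)) ?nnegrE ?addr_ge0 ?sqrtr_ge0//.
rewrite sqrrD !sqr_sqrtr// nsqD -[in leRHS]mulr_natl [leRHS]addrAC lerD2l ler_pM2l//.
rewrite -sqrtrM// (le_trans (ler_norm _))// -sqrtr_sqr ler_wsqrtr//.
exact: CauchySchwarz_Re.
Qed.

Lemma nsqD_le u v : nsq (u + v) <= 2 * (nsq u + nsq v).
Proof. by have := nsq_ge0 (u - v); rewrite nsqB nsqD; lra. Qed.

Lemma nsqB_le u v : nsq (u - v) <= 2 * (nsq u + nsq v).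
Proof. by have := nsq_ge0 (u + v); rewrite nsqB nsqD; lra. Qed.

End InnerProduct.
#[global] Hint Extern 0 (is_true (0 <= nsq _ _)) => exact: nsq_ge0 : core.

Section Hilbert.
Variables (R : realType) (V : sepHilbertType R).
Implicit Types (u v w : V) (z : R[i]).

Lemma hdotDl u v w : hdot (u + v) w = hdot u w + hdot v w.
Proof. exact: linearDl. Qed.
Lemma hdotDr u v w : hdot w (u + v) = hdot w u + hdot w v.
Proof. exact: linearDr. Qed.
Lemma hdotBl u v w : hdot (u - v) w = hdot u w - hdot v w.
Proof. exact: linearBl. Qed.
Lemma hdotBr u v w : hdot w (u - v) = hdot w u - hdot w v.
Proof. exact: linearBr. Qed.
Lemma hdotZl z u v : hdot (z *: u) v = z * hdot u v.
Proof. exact: linearZl_LR. Qed.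
Lemma hdotZr z u v : hdot u (z *: v) = conjC z * hdot u v.
Proof. exact: linearZr_LR. Qed.
Lemma hdot0l u : hdot (0 : V) u = 0. Proof. exact: linear0l. Qed.
Lemma hdot0r u : hdot u (0 : V) = 0. Proof. exact: linear0r. Qed.

Lemma hdot_inj u v : (forall w, hdot w u = hdot w v) -> u = v.
Proof.
move=> uv; apply/eqP; rewrite -subr_eq0 -(dnorm_eq0 (@hdot R V)).
by rewrite hdotBr uv subrr.
Qed.

Lemma normsqE u : `|u| ^+ 2 = (nsq hdot u)%:C.
Proof. by rewrite nsqE sqr_normE. Qed.

Lemma normE u : `|u| = (Num.sqrt (nsq hdot u))%:C.
Proof.
apply/eqP; rewrite -(@eqrXn2 _ 2)// ?ler0c ?sqrtr_ge0//.
by rewrite normsqE -rmorphXn/= sqr_sqrtr.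
Qed.

Lemma norm_ltC u (e : R) : 0 <= e -> (`|u| < e%:C) = (nsq hdot u < e ^+ 2).
Proof.
move=> e0; rewrite -(@ltr_pXn2r _ 2)// ?nnegrE ?ler0c// normsqE -rmorphXn/=.
exact: ltcR.
Qed.
End Hilbert.

(** * The Riesz representation theorem *)

Lemma gt0_ReK (R : realType) (e : R[i]) : 0 < e ->
  0 < complex.Re e /\ e = (complex.Re e)%:C.
Proof.
move=> e0; have eE : e = (complex.Re e)%:C by rewrite RRe_real// gtr0_real.
by split => //; rewrite -(ltcR 0) -eE.
Qed.

(** The representing vector minimizes q x = |x|^2 - 2 Re (f x), the square of
    the distance to it up to a constant.  The sublevel sets of q near its
    infimum m generate a Cauchy filter by the parallelogram identity; the
    first-order condition, quantified by discriminant_le at almost minimal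
    points, passes to the limit p. *)
Section Riesz.
Variables (R : realType) (V : sepHilbertType R) (f : V -> R[i]).
Hypothesis f_lin : forall (a : R[i]) u v, f (a *: u + v) = a * f u + f v.
Variable M : R.
Hypothesis M_ge0 : 0 <= M.
Hypothesis f_bnd : forall x, complex.Re (f x) ^+ 2 <= M * nsq hdot x.

Let q x := nsq hdot x - 2 * complex.Re (f x).
Let m := inf (range q).

Let fRe (t : R) u v :
  complex.Re (f (u + t%:C *: v)) = complex.Re (f u) + t * complex.Re (f v).
Proof.
by rewrite addrC f_lin addrC raddfD/=; case: (f v) => a b /=; rewrite mul0r subr0.
Qed.

Let q_add x v (t : R) : q (x + t%:C *: v) =
  q x + 2 * t * complex.Re (hdot x v - f v) + t ^+ 2 * nsq hdot v.
Proof.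
rewrite /q nsqD nsqZ Re_dotZr -add_Re2_Im2/= fRe raddfB/=; ring.
Qed.

Let q_has_inf : has_inf (range q).
Proof.
split; first by exists (q 0), 0.
exists (- M) => _ [x _ <-].
(* |f x|^2 <= M |x|^2 and the inequality between the two means *)
have := f_bnd x; have := nsq_ge0 hdot x; rewrite /q.
move: (nsq _ _) (complex.Re _) => a r a0 ra.
have : 2 * r <= a + M; last by lra.
rewrite leNgt; apply/negP => h.
have h2 : (a + M) * (a + M) < 2 * r * (2 * r) by apply: ltr_pM; rewrite ?addr_ge0.
have := sqr_ge0 (a - M); move: ra h2; rewrite !expr2; lra.
Qed.

Let q_ge x : m <= q x.
Proof. by apply: ge_inf; [case: q_has_inf|exists x]. Qed.

Let parallelogram x y : nsq hdot (x - y) <= 2 * (q x + q y - 2 * m).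
Proof.
have := q_ge (x + (2^-1)%:C *: (y - x)).
rewrite q_add raddfB/= hdotBr !raddfB/=.
have -> : complex.Re (f (y - x)) = complex.Re (f y) - complex.Re (f x).
  by rewrite [y - x]addrC -(scaleN1r x) f_lin mulN1r addrC raddfB.
rewrite /q -[y - x]opprB nsqN !nsqB; rewrite /nsq -/(nsq _ _).
move: (complex.Re (hdot x y)) (complex.Re (f x)) (complex.Re (f y)).
rewrite /nsq; move: (complex.Re (hdot x x)) (complex.Re (hdot y y)).
move=> a b c d e; lra.
Qed.

Let F := filter_from [set e : R | 0 < e] (fun e => [set x | q x < m + e]).

Let F_proper : ProperFilter F.
Proof.
have FF : Filter F.
  apply: filter_from_filter; first by exists 1 => /=.
  move=> i j /= i0 j0; exists (minr i j); first by rewrite /= lt_min i0.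
  by move=> x /= h; split; apply: (lt_le_trans h); rewrite lerD2l ge_min lexx ?orbT.
apply: filter_from_proper => e e0.
have [_ [x _ <-] h] := inf_adherent e0 q_has_inf.
by exists x.
Qed.

Let F_cauchy : cauchy F.
Proof.
have FF := F_proper; apply/cauchy_ballP => e /gt0_ReK[]; set d := complex.Re e => d0 ->.
have d2 : 0 < d ^+ 2 / 4 by rewrite divr_gt0// exprn_gt0.
exists ([set x | q x < m + d ^+ 2 / 4], [set x | q x < m + d ^+ 2 / 4]).
  by split; exists (d ^+ 2 / 4).
move=> [x y] /= [hx hy]; rewrite -ball_normE/= norm_ltC ?ltW//.
by apply: (le_lt_trans (parallelogram _ _)); lra.
Qed.

Lemma Riesz : exists p, forall v, f v = hdot v p.
Proof.
have FF := F_proper; have /cauchy_cvg/cvg_ex[/= p Fp] := F_cauchy.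
have near_p e : 0 < e -> exists2 x, q x < m + e & nsq hdot (p - x) < e.
  move=> e0.
  have s0 : 0 < Num.sqrt e by rewrite sqrtr_gt0.
  have A : F [set x | `|p - x| < (Num.sqrt e)%:C].
    apply: Fp; apply/nbhs_ballP; exists (Num.sqrt e)%:C; first by rewrite /= ltcR.
    by move=> x; rewrite -ball_normE.
  have B : F [set x | q x < m + e] by exists e.
  have [x [/= xp xq]] := filter_ex (filterI A B).
  by exists x => //; move: xp; rewrite norm_ltC ?ltW// sqr_sqrtr// ltW.
have re0 v : complex.Re (hdot p v - f v) = 0.
  (* c is controlled by any e > 0, through a point x with q x < m + e *)
  pose c := complex.Re (hdot p v - f v); rewrite -/c.
  have bnd e : 0 < e -> c ^+ 2 <= 4 * (e * nsq hdot v).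
    move=> e0; have [x xq xp] := near_p e e0.
    have h1 : complex.Re (hdot x v - f v) ^+ 2 <= e * nsq hdot v.
      apply: discriminant_le => // t.
      by have := q_ge (x + t%:C *: v); rewrite q_add; lra.
    have h2 : complex.Re (hdot (p - x) v) ^+ 2 <= e * nsq hdot v.
      by rewrite (le_trans (CauchySchwarz_Re _ _ _))// ler_wpM2r// ltW.
    have -> : c = complex.Re (hdot (p - x) v) + complex.Re (hdot x v - f v).
      by rewrite /c hdotBl !raddfB/=; ring.
    have := sqr_ge0 (complex.Re (hdot (p - x) v) - complex.Re (hdot x v - f v)).
    nra.
  apply/eqP; rewrite -sqrf_eq0 eq_le sqr_ge0 andbT.
  apply/ler_addgt0Pl => e e0; rewrite addr0.
  have n1 : 0 < nsq hdot v + 1 by rewrite ltr_wpDl.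
  apply: (le_trans (bnd (e / (4 * (nsq hdot v + 1))) _)).
    by rewrite divr_gt0// mulr_gt0.
  have -> : 4 * (e / (4 * (nsq hdot v + 1)) * nsq hdot v) =
            e * (nsq hdot v / (nsq hdot v + 1)) by field; rewrite gt_eqF.
  by apply: ler_piMr; rewrite ?(ltW e0)// ler_pdivrMr// mul1r lerDl.
have f0 : f 0 = 0.
  by have := f_lin (-1) 0 0; rewrite scaler0 addr0 mulN1r addNr.
(* the imaginary part is the real part at 'i *: v *)
exists p => v; have := re0 v; have := re0 ('i *: v).
rewrite !raddfB/= !(dotC _ _ p) !ReC hdotZl -[in f ('i *: v)](addr0 ('i *: v)).
rewrite f_lin f0 addr0.
case: (f v) (hdot v p) => a b [c d] /= ? ?; congr Complex; lra.
Qed.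

End Riesz.

(** * Sums of complex series *)

Section Summation.
Variable R : realType.
Implicit Types a b : nat -> R[i].

(** Splitting into real and imaginary parts makes the completeness of the real
    line available. *)
Definition csummable a :=
  cvgn (series (@complex.Re R \o a)) /\ cvgn (series (@complex.Im R \o a)).

Definition csum a : R[i] :=
  Complex (limn (series (@complex.Re R \o a))) (limn (series (@complex.Im R \o a))).

Let ReD a b : @complex.Re R \o (a \+ b) = (@complex.Re R \o a) + (@complex.Re R \o b).
Proof. by apply/funext => n /=; rewrite raddfD. Qed.
Let ImD a b : @complex.Im R \o (a \+ b) = (@complex.Im R \o a) + (@complex.Im R \o b).
Proof. by apply/funext => n /=; rewrite raddfD. Qed.

Lemma csumD a b : csummable a -> csummable b -> csum (a \+ b) = csum a + csum b.
Proof.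
by move=> [a1 a2] [b1 b2]; rewrite /csum ReD ImD !lim_seriesD.
Qed.

Let ReZ z a : @complex.Re R \o (fun n => z * a n) =
  complex.Re z *: (@complex.Re R \o a) - complex.Im z *: (@complex.Im R \o a).
Proof. by apply/funext => n; rewrite /= !fctE/=; case: z => ? ?; case: (a n). Qed.
Let ImZ z a : @complex.Im R \o (fun n => z * a n) =
  complex.Re z *: (@complex.Im R \o a) + complex.Im z *: (@complex.Re R \o a).
Proof. by apply/funext => n; rewrite /= !fctE/=; case: z => ? ?; case: (a n). Qed.

Lemma csummableZ z a : csummable a -> csummable (fun n => z * a n).
Proof.
move=> [a1 a2]; split; rewrite ?ReZ ?ImZ.
  by apply: is_cvg_seriesB; exact: is_cvg_seriesZ.
by apply: is_cvg_seriesD; exact: is_cvg_seriesZ.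
Qed.

Lemma csumZ z a : csummable a -> csum (fun n => z * a n) = z * csum a.
Proof.
move=> [a1 a2]; rewrite /csum ReZ ImZ lim_seriesB ?lim_seriesD; try exact: is_cvg_seriesZ.
by rewrite !lim_seriesZ//; case: z.
Qed.

Lemma csumC a : csummable a -> csum (fun n => conjC (a n)) = conjC (csum a).
Proof.
move=> [a1 a2]; rewrite [RHS]/=; congr Complex.
  by congr (limn (series _)); apply/funext => n /=; rewrite ReC.
rewrite -lim_seriesN//; congr (limn (series _)); apply/funext => n /=.
by rewrite /GRing.opp/=; case: (a n).
Qed.

Lemma csum_fin a N : (forall n, (N <= n)%N -> a n = 0) ->
  csummable a /\ csum a = \sum_(n < N) a n.
Proof.
move=> a0.
have H (f : {additive R[i] -> R}) : series (f \o a) @ \oo --> f (\sum_(n < N) a n).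
  apply: cvg_near_cst; near=> n; rewrite /series/= raddf_sum -(big_mkord predT (f \o a)).
  rewrite [LHS](big_cat_nat (n := N))//=; last by near: n; exact: nbhs_infty_ge.
  rewrite [X in _ + X = _]big_nat_cond [X in _ + X = _]big1 ?addr0//.
  by move=> i /andP[/andP[Ni _] _]; rewrite a0// raddf0.
have [H1 H2] := (H (@complex.Re R : {additive _ -> _}), H (@complex.Im R : {additive _ -> _})).
split; first by split; [exact: cvgP H1|exact: cvgP H2].
by rewrite /csum (cvg_lim _ H1)// (cvg_lim _ H2)//; case: (\sum_(n < N) _).
Unshelve. all: by end_near. Qed.

Lemma csum_shift a : csummable a ->
  csummable (a \o S) /\ csum a = a 0%N + csum (a \o S).
Proof.
move=> [a1 a2].
have H (f : R[i] -> R) : cvgn (series (f \o a)) ->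
    series (f \o (a \o S)) @ \oo --> limn (series (f \o a)) - f (a 0%N).
  move=> fa.
  rewrite (_ : series _ = (fun n => series (f \o a) n.+1 - f (a 0%N))).
    by apply: cvgB; [rewrite (cvg_shiftS (series (f \o a)))|exact: cvg_cst].
  by apply/funext => n; rewrite /series/= big_nat_recl//= addrC addKr.
have [H1 H2] := (H _ a1, H _ a2).
split; first by split; [exact: cvgP H1|exact: cvgP H2].
rewrite /csum (cvg_lim _ H1)// (cvg_lim _ H2)//.
by case: (a 0%N) => c d; congr Complex; rewrite /= addrC subrK.
Qed.

End Summation.

(** * The Hilbert space l^2(E) *)

Section NonnegativeSeries.
Variables (R : realType) (a : nat -> R).
Hypothesis a0 : forall n, 0 <= a n.

Let series_nd : {homo series a : n m / (n <= m)%N >-> n <= m}.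
Proof. by apply/nondecreasing_seqP => n; rewrite /series/= big_nat_recr//= lerDl. Qed.

Lemma series_le_limn N : cvgn (series a) -> series a N <= limn (series a).
Proof. by move=> ac; exact: nondecreasing_cvgn_le. Qed.

Lemma nonneg_series_cvg C : (forall N, series a N <= C) ->
  cvgn (series a) /\ limn (series a) <= C.
Proof.
move=> aC; have ac : cvgn (series a).
  by apply: nondecreasing_is_cvgn => //; exists C => _ [n _ <-]; exact: aC.
by split => //; apply: limr_le => //; exact: nearW.
Qed.

Lemma limn_series_eq0 n : cvgn (series a) -> limn (series a) = 0 -> a n = 0.
Proof.
move=> ac l0; apply/eqP; rewrite eq_le a0 andbT -l0.
apply: le_trans (series_le_limn n.+1 ac); rewrite /series/= big_nat_recr//= lerDr.
by rewrite sumr_ge0.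
Qed.
End NonnegativeSeries.

Section SquareSummable.
Variables (R : realType) (E : sepHilbertType R).

Definition sqsummable : {pred nat -> E} :=
  fun x => `[< cvgn (series (fun n => nsq hdot (x n))) >].

Lemma sqsummableP (x : nat -> E) :
  reflect (cvgn (series (fun n => nsq hdot (x n)))) (x \in sqsummable).
Proof. exact: asboolP. Qed.

Lemma sqsummable_le (a : nat -> R) (x : nat -> E) :
  (forall n, nsq hdot (x n) <= a n) -> cvgn (series a) -> x \in sqsummable.
Proof.
move=> xa ac; apply/sqsummableP; apply: (series_le_cvg _ _ xa ac) => //.
by move=> n; exact: le_trans (xa n).
Qed.

Lemma sqsummable_submod : submod_closed sqsummable.
Proof.
split=> [|z x y /sqsummableP xc /sqsummableP yc].
  apply: (@sqsummable_le (fun=> 0)) => [n|]; first by rewrite /nsq hdot0l.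
  rewrite (_ : series _ = cst 0); first exact: is_cvg_cst.
  by apply/funext => n; rewrite /series/= big1.
apply: (@sqsummable_le ((2 * complex.Re (`|z| ^+ 2)) *: (fun n => nsq hdot (x n)) +
                       2 *: (fun n => nsq hdot (y n)))) => [n|].
  by rewrite !fctE/= (le_trans (nsqD_le _ _ _))// nsqZ mulrDr mulrA.
by apply: is_cvg_seriesD; exact: is_cvg_seriesZ.
Qed.

HB.instance Definition _ :=
  GRing.isSubmodClosed.Build R[i] (nat -> E) sqsummable sqsummable_submod.

Record ell2 := Ell2 { ell2_val :> nat -> E ; _ : ell2_val \in sqsummable }.

HB.instance Definition _ := [isSub for ell2_val].
HB.instance Definition _ := [Choice of ell2 by <:].
HB.instance Definition _ := [SubChoice_isSubLmodule of ell2 by <:].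

Lemma ell2_cvg (x : ell2) : cvgn (series (fun n => nsq hdot (x n))).
Proof. by apply/sqsummableP; exact: (valP x). Qed.

Lemma ell2_ext (x y : ell2) : (forall n, x n = y n) -> x = y.
Proof. by move=> xy; apply/val_inj/funext. Qed.

Lemma ell2_linE z (x y : ell2) n : (z *: x + y) n = z *: x n + y n.
Proof. by []. Qed.

Let Re_dot_le (u v : E) : `|complex.Re (hdot u v)| <= nsq hdot u + nsq hdot v.
Proof.
have := nsq_ge0 hdot (u + v); have := nsq_ge0 hdot (u - v).
have := nsq_ge0 hdot u; have := nsq_ge0 hdot v.
by rewrite nsqB nsqD ler_norml => *; apply/andP; split; lra.
Qed.

(** Replacing v by 'i *: v turns the imaginary part into the real one. *)
Let Im_dot_le (u v : E) : `|complex.Im (hdot u v)| <= nsq hdot u + nsq hdot v.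
Proof.
have -> : complex.Im (hdot u v) = complex.Re (hdot u ('i *: v)).
  by rewrite hdotZr; case: (hdot u v) => a b /=; ring.
apply: (le_trans (Re_dot_le _ _)).
by rewrite nsqZ -add_Re2_Im2/= expr0n expr1n add0r mul1r.
Qed.

Lemma dot_summable (x y : ell2) : csummable (fun n => hdot (x n) (y n)).
Proof.
have c := is_cvg_seriesD (@ell2_cvg x) (@ell2_cvg y).
split; apply: normed_cvg; apply: (series_le_cvg _ _ _ c) => //= n; rewrite ?fctE//.
  by rewrite addr_ge0.
by rewrite addr_ge0.
Qed.

Definition ell2_dot (x y : ell2) : R[i] := csum (fun n => hdot (x n) (y n)).

Let dotPl z (x y w : ell2) :
  ell2_dot (z *: x + y) w = z * ell2_dot x w + ell2_dot y w.
Proof.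
rewrite /ell2_dot -csumZ; last exact: dot_summable.
rewrite -csumD; [|exact/csummableZ/dot_summable|exact: dot_summable].
by congr csum; apply/funext => n; rewrite hdotDl hdotZl.
Qed.

Let ell2_dotC (x y : ell2) : ell2_dot x y = (-1) ^+ false * conjC (ell2_dot y x).
Proof.
rewrite mul1r /ell2_dot -csumC; last exact: dot_summable.
by congr csum; apply/funext => n; rewrite dotC.
Qed.

Let dot_bilinear :
  bilinear_for ( *%R : GRing.Scale.law _ _) (conjC \; *%R) ell2_dot.
Proof.
split=> [v a x y|v a x y]; rewrite /=; first exact: dotPl.
by rewrite ell2_dotC mul1r dotPl rmorphD rmorphM/= !(ell2_dotC v) !mul1r.
Qed.

HB.instance Definition _ :=
  bilinear_isBilinear.Build R[i] ell2 ell2 R[i] *%R (conjC \; *%R) ell2_dot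
    dot_bilinear.

HB.instance Definition _ :=
  isHermitianSesquilinear.Build R[i] ell2 false conjC ell2_dot ell2_dotC.

Let dot_diag (x : ell2) :
  ell2_dot x x = (limn (series (fun n => nsq hdot (x n))))%:C.
Proof.
rewrite /ell2_dot /csum; congr Complex.
rewrite (_ : _ \o _ = fun=> 0); last first.
  by apply/funext => n /=; rewrite -nsqE.
rewrite (_ : series _ = cst 0) ?lim_cst//.
by apply/funext => n; rewrite /series/= big1.
Qed.

Let dot_gt0 (x : ell2) : x != 0 -> 0 < ell2_dot x x.
Proof.
move=> x0; rewrite dot_diag ltcR lt_def.
have xc := @ell2_cvg x; apply/andP; split.
  apply: contra x0 => /eqP l0; apply/eqP/ell2_ext => n; apply/eqP.
  by rewrite -(nsq_eq0 hdot); apply/eqP; exact: (limn_series_eq0 _ n xc l0).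
apply: le_trans (series_le_limn _ 0%N xc) => //.
by rewrite /series/= big_geq.
Qed.

HB.instance Definition _ := isDotProduct.Build R[i] ell2 ell2_dot dot_gt0.

Lemma ell2_nsq (x : ell2) :
  nsq ell2_dot x = limn (series (fun n => nsq hdot (x n))).
Proof. by rewrite -[LHS]/(complex.Re (ell2_dot x x)) dot_diag. Qed.

Lemma ell2_nsq_ge (x : ell2) N :
  series (fun n => nsq hdot (x n)) N <= nsq ell2_dot x.
Proof. by rewrite ell2_nsq series_le_limn//; exact: ell2_cvg. Qed.

Lemma ell2_nsq_coord (x : ell2) n : nsq hdot (x n) <= nsq ell2_dot x.
Proof.
apply: le_trans (ell2_nsq_ge x n.+1); rewrite /series/= big_nat_recr//= lerDr.
by rewrite sumr_ge0.
Qed.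

Lemma ell2_exists (x : nat -> E) C :
  (forall N, series (fun n => nsq hdot (x n)) N <= C) ->
  exists2 y : ell2, (forall n, y n = x n) & nsq ell2_dot y <= C.
Proof.
move=> xC; have [|xc xl] := nonneg_series_cvg _ xC => //.
have /sqsummableP xs := xc.
by exists (Ell2 xs) => //; rewrite ell2_nsq.
Qed.

Lemma ell2_nsq_le (x : ell2) C :
  (forall N, series (fun n => nsq hdot (x n)) N <= C) -> nsq ell2_dot x <= C.
Proof. by move=> xC; rewrite ell2_nsq; case: (nonneg_series_cvg _ xC). Qed.

Definition ell2_norm (x : ell2) : R[i] := (Num.sqrt (nsq ell2_dot x))%:C.

Let ell2_normD (x y : ell2) : ell2_norm (x + y) <= ell2_norm x + ell2_norm y.
Proof. by rewrite -rmorphD lecR; exact: sqrt_nsqD. Qed.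

Let ell2_normZ (l : R[i]) (x : ell2) : ell2_norm (l *: x) = `|l| * ell2_norm x.
Proof.
rewrite /ell2_norm nsqZ sqrtrM; last by rewrite -add_Re2_Im2/= addr_ge0 ?sqr_ge0.
by rewrite -add_Re2_Im2 normc_def -rmorphM.
Qed.

Let ell2_norm0_eq0 (x : ell2) : ell2_norm x = 0 -> x = 0.
Proof.
move=> /(congr1 (@complex.Re R))/= /eqP; rewrite sqrtr_eq0 => x0.
by apply/eqP; rewrite -(nsq_eq0 ell2_dot) eq_le x0/=.
Qed.

HB.instance Definition _ :=
  Lmodule_isNormed.Build R[i] ell2 ell2_normD ell2_normZ ell2_norm0_eq0.

Lemma ell2_norm_ltC (x : ell2) (e : R) : 0 <= e ->
  (`|x| < e%:C) = (nsq ell2_dot x < e ^+ 2).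
Proof.
move=> e0; rewrite [`|x|]/(ell2_norm x) ltcR.
by rewrite -(@ltr_pXn2r _ 2)// ?nnegrE ?sqrtr_ge0// sqr_sqrtr.
Qed.
End SquareSummable.

Section Ell2Hilbert.
Variables (R : realType) (E : sepHilbertType R).
Local Notation ell2 := (ell2 E).
Local Notation nsq2 := (nsq (@ell2_dot R E)).

Let ltC (x : ell2) (e : R) : 0 <= e -> (`|x| < e%:C) = (nsq2 x < e ^+ 2).
Proof. exact: ell2_norm_ltC. Qed.

(** The limit p is computed slot by slot, and the norm of x - p is bounded
    through its partial sums: on finitely many slots p can be approximated by a
    member y of the Cauchy filter, whence
    |x - p|^2 <= 2 (|p - y|^2 + |x - y|^2) there, with a bound that does not
    depend on the number of slots. *)
Let ell2_complete (F : set_system ell2) : ProperFilter F -> cauchy F -> cvg F.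
Proof.
move=> FF /cauchy_ballP Fc.
have Fd (d : R) : 0 < d -> exists A, exists2 B, F A /\ F B &
    forall x y : ell2, A x -> B y -> nsq2 (x - y) < d.
  move=> d0; have s0 : 0 < Num.sqrt d by rewrite sqrtr_gt0.
  have [[A B]/= [FA FB] AB] := Fc (Num.sqrt d)%:C (etrans (ltcR _ _) s0).
  exists A, B => // x y Ax By; have := AB (x, y) (conj Ax By).
  by rewrite -ball_normE/= ltC ?ltW// sqr_sqrtr// ltW.
have /choice[p Fp] : forall n, exists p : E, forall d, 0 < d ->
    F [set x | nsq hdot (p - x n) < d].
  move=> n.
  have /cauchy_cvg/cvg_ex[/= p Fp] : cauchy ((fun x : ell2 => x n) @ F : set_system E).
    apply/cauchy_ballP => e /gt0_ReK[]; set d := complex.Re e => d0 ->.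
    have [A [B [FA FB] AB]] := Fd (d ^+ 2) (exprn_gt0 _ d0).
    exists ((fun x : ell2 => x n) @` A, (fun x : ell2 => x n) @` B).
      split; [apply: (@filterS _ F _ A _ _ FA)|apply: (@filterS _ F _ B _ _ FB)];
        by move=> x ?; exists x.
    move=> _ /= [[x Ax <-] [y By <-]].
    rewrite -ball_normE/= norm_ltC ?ltW//.
    exact: (le_lt_trans (ell2_nsq_coord (x - y) n) (AB _ _ Ax By)).
  exists p => d d0; have s0 : 0 < Num.sqrt d by rewrite sqrtr_gt0.
  move/cvgrPdist_lt : Fp => /(_ (Num.sqrt d)%:C (etrans (ltcR _ _) s0)).
  by apply: filterS => x; rewrite norm_ltC ?ltW// sqr_sqrtr// ltW.
have Fsum N d : 0 < d -> F [set x | series (fun n => nsq hdot (p n - x n)) N < d].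
  elim: N d => [|N IHN] d d0.
    by apply: (filterS _ filterT) => x _; rewrite /series/= big_geq.
  have d20 : 0 < d / 2 by rewrite divr_gt0.
  apply: (filterS _ (filterI (IHN _ d20) (Fp N _ d20))) => x [/= h1 h2].
  by rewrite /series/= big_nat_recr//= [ltRHS]splitr ltrD.
have close d : 0 < d -> exists2 A, F A & forall x, A x -> forall N,
    series (fun n => nsq hdot (p n - x n)) N <= d.
  move=> d0; have d40 : 0 < d / 4 by rewrite divr_gt0.
  have [A [B [FA FB] AB]] := Fd _ d40.
  exists A => // x Ax N.
  have [y [/= h By]] := filter_ex (filterI (Fsum N _ d40) FB).
  apply: (@le_trans _ _ (2 * (series (fun n => nsq hdot (p n - y n)) N) +
                        2 * (series (fun n => nsq hdot ((x - y) n)) N))).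
    rewrite /series/= !mulr_sumr -big_split/=; apply: ler_sum => n _.
    rewrite (_ : p n - x n = (p n - y n) - (x - y) n) -?mulrDr ?nsqB_le//.
    by rewrite opprB addrA subrK.
  have := ell2_nsq_ge (x - y) N; have := AB _ _ Ax By; lra.
have [A FA Ax] := close _ ltr01.
have [x0 /Ax x0p] := filter_ex FA.
have [q qE _] := ell2_exists x0p.
pose P := q + x0.
have PE n : P n = p n by rewrite -[LHS]/(q n + x0 n) qE subrK.
apply/cvg_ex; exists P; apply/cvgrPdist_lt => e /gt0_ReK[].
set d := complex.Re e => d0 ->.
have d20 : 0 < d ^+ 2 / 2 by rewrite divr_gt0// exprn_gt0.
have [B FB Bx] := close _ d20.
apply: filterS FB => x /Bx xB; rewrite ltC ?ltW//.
apply: (@le_lt_trans _ _ (d ^+ 2 / 2)); last by lra.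
apply: ell2_nsq_le => N; apply: le_trans (xB N).
by rewrite /series/=; apply: ler_sum => n _; rewrite -PE.
Qed.

HB.instance Definition _ := Uniform_isComplete.Build ell2 ell2_complete.

(** The finitely supported sequences with values in a countable dense part of E
    are encoded by lists of natural numbers. *)
Let ell2_separable : exists2 S : set ell2, countable S & dense S.
Proof.
have [S /countable_injP[f finj] dS] := @hilbert_separable R E.
pose T := [set x : ell2 | exists2 s : seq E, (forall v, v \in s -> S v) &
  forall n, x n = nth 0 s n].
exists T.
  have /choice[s sP] : forall x : ell2, exists s : seq E, T x ->
      (forall v, v \in s -> S v) /\ forall n, x n = nth 0 s n.
    move=> x; have [[s s1 s2]|nT] := pselect (T x); first by exists s.
    by exists [::] => /nT.
  apply/countable_injP; exists (fun x => pickle (map f (s x))) => x y.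
  rewrite !inE => /sP[xS xE] /sP[yS yE] /(pcan_inj pickleK) xy.
  have {}xy : s x = s y.
    apply: (inj_in_map (A := mem S) finj) xy.
      by rewrite inE; apply/allP => v /xS ?; rewrite inE.
    by rewrite inE; apply/allP => v /yS ?; rewrite inE.
  by apply: ell2_ext => n; rewrite xE yE xy.
move=> O [x Ox] oO.
have /nbhs_ballP[e /= /gt0_ReK[]] : nbhs x O by exact: open_nbhs_nbhs.
set d := complex.Re e => d0 -> xeO.
have d20 : 0 < d ^+ 2 / 4 by rewrite divr_gt0// exprn_gt0.
have xc := @ell2_cvg _ _ x.
have [N xN] : exists N, nsq2 x - d ^+ 2 / 4 < series (fun n => nsq hdot (x n)) N.
  apply: contrapT => /forallNP h.
  have : nsq2 x <= nsq2 x - d ^+ 2 / 4; last by lra.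
  by apply: ell2_nsq_le => N; rewrite leNgt; apply/negP/h.
have [N' NN'] : exists N' : R, N' = N%:R + 1 by eexists.
have N'0 : 0 < N' by rewrite NN' ltr_wpDl.
have eta0 : 0 < d ^+ 2 / 4 / N' by rewrite divr_gt0.
have /choice[t tP] : forall n, exists t, S t /\ nsq hdot (x n - t) < d ^+ 2 / 4 / N'.
  move=> n; have s0 : 0 < Num.sqrt (d ^+ 2 / 4 / N') by rewrite sqrtr_gt0.
  have [|t [xt St]] := dS (ball (x n) (Num.sqrt (d ^+ 2 / 4 / N'))%:C) _ (ball_open _ _).
    by exists (x n); apply: ballxx; rewrite ltcR.
  exists t; split => //; move: xt; rewrite -ball_normE/= norm_ltC ?ltW//.
  by rewrite sqr_sqrtr// ltW.
pose y n := nth 0 (mkseq t N) n.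
have dist M : series (fun n => nsq hdot (x n - y n)) M <= d ^+ 2 / 2.
  apply: (@le_trans _ _ (series (fun n => nsq hdot (x n - y n)) (N + M)%N)).
    rewrite /series/= [leRHS](big_cat_nat (n := M)) ?leq_addl//= lerDl.
    by rewrite sumr_ge0.
  rewrite /series/= (big_cat_nat (n := N)) ?leq_addr//=.
  rewrite (_ : d ^+ 2 / 2 = d ^+ 2 / 4 + d ^+ 2 / 4); last by field.
  apply: lerD.
    apply: (@le_trans _ _ (\sum_(0 <= n < N) d ^+ 2 / 4 / N')).
      apply: ler_sum_nat => n /andP[_ nN]; rewrite /y nth_mkseq//.
      by case: (tP n) => _ /ltW.
    rewrite sumr_const_nat subn0 -[leLHS]mulr_natr -[leLHS]mulrA.
    apply: ler_piMr; first exact: ltW.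
    by rewrite mulrC ler_pdivrMr// mul1r NN' lerDl.
  have := ell2_nsq_ge x (N + M)%N.
  rewrite {1}/series/= (big_cat_nat (n := N)) ?leq_addr//=.
  set a := \sum_(N <= _ < _) _; set b := \sum_(N <= _ < _) _.
  have -> : b = a; last by move: xN; rewrite /series/=; lra.
  apply: eq_big_nat => n /andP[Nn _].
  by rewrite /y nth_default ?size_mkseq// subr0.
have [z zE zd] := ell2_exists dist.
exists (x - z); split.
  apply: xeO; rewrite -ball_normE/= opprB addrC subrK ltC ?ltW//.
  by apply: (le_lt_trans zd); have := exprn_gt0 2 d0; lra.
exists (mkseq t N); first by move=> v /mapP[n _ ->]; case: (tP n).
by move=> n; rewrite -[LHS]/(x n - z n) zE opprB addrC subrK.
Qed.

Let ell2_sqr_norm (x : ell2) : `|x| ^+ 2 = ell2_dot x x.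
Proof.
by rewrite -[RHS]nsqE [`|x|]/(ell2_norm x) /ell2_norm -rmorphXn/= sqr_sqrtr.
Qed.

HB.instance Definition _ := CompleteNormedModule_isSepHilbert.Build R ell2
  ell2_sqr_norm ell2_separable.
End Ell2Hilbert.

Lemma hdot_ell2E (R : realType) (E : sepHilbertType R) (x y : ell2 E) :
  hdot x y = csum (fun n => hdot (x n) (y n)).
Proof. by []. Qed.

(** * Bounded operators and their adjoints *)

Section BoundedLinear.
Variable R : realType.
Implicit Types V W E : sepHilbertType R.

(** Unbundled, so that closure under composition, sums and pairing can be
    proved for plain functions; to_bounded bundles the result.  Bounding squares
    of norms keeps every estimate in R. *)
Definition blin V W (f : V -> W) := linear f /\
  exists2 M : R, 0 <= M & forall x, nsq hdot (f x) <= M * nsq hdot x.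

Lemma nsq_le_norm V W (f : V -> W) (M : R) (x : V) : 0 <= M ->
  nsq hdot (f x) <= M * nsq hdot x -> `|f x| <= (Num.sqrt M)%:C * `|x|.
Proof. by move=> M0 h; rewrite !normE -rmorphM lecR -sqrtrM// ler_wsqrtr. Qed.

Lemma norm_le_nsq V W (f : V -> W) (M : R[i]) (x : V) :
  `|f x| <= M * `|x| -> nsq hdot (f x) <= complex.Re (`|M| ^+ 2) * nsq hdot x.
Proof.
move=> h; have -> : complex.Re (`|M| ^+ 2) * nsq hdot x = complex.Re (`|M| ^+ 2 * `|x| ^+ 2).
  by rewrite normsqE -add_Re2_Im2 -rmorphM.
rewrite -lecR -normsqE RRe_real ?realM ?realX// -exprMn.
rewrite ler_pXn2r ?nnegrE ?mulr_ge0//.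
apply: (le_trans h); rewrite -[leLHS]ger0_norm ?normrM ?normr_id//.
exact: le_trans h.
Qed.

Lemma blin_bounded V W (T : {bounded V -> W}) : blin T.
Proof.
split; first exact: linearP.
have [M TM] := bounded_op (s := T); exists (complex.Re (`|M| ^+ 2)).
  by rewrite -add_Re2_Im2/= addr_ge0 ?sqr_ge0.
by move=> x; exact: norm_le_nsq.
Qed.

Lemma blin_norm V W (f : V -> W) : blin f ->
  exists M : R[i], forall x, `|f x| <= M * `|x|.
Proof.
by move=> [_ [M M0 fM]]; exists (Num.sqrt M)%:C => x; exact: nsq_le_norm.
Qed.

Definition to_bounded V W (f : V -> W) (fb : blin f) : {bounded V -> W} :=
  HB.pack f (GRing.isLinear.Build R[i] V W *:%R f fb.1)
    (isBoundedOp.Build R[i] V W f (blin_norm fb)).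

Lemma blinP V W (f : V -> W) a u v : blin f -> f (a *: u + v) = a *: f u + f v.
Proof. by move=> [fl _]; exact: fl. Qed.

Lemma blin0 V W (f : V -> W) : blin f -> f 0 = 0.
Proof. by move=> fb; have := blinP (-1) 0 0 fb; rewrite scaler0 addr0 scaleN1r addNr. Qed.

Lemma blinD V W (f : V -> W) u v : blin f -> f (u + v) = f u + f v.
Proof. by move=> fb; rewrite -[u]scale1r blinP// !scale1r. Qed.

Lemma blinZ V W (f : V -> W) a u : blin f -> f (a *: u) = a *: f u.
Proof. by move=> fb; rewrite -[a *: u]addr0 blinP// blin0// addr0. Qed.

Lemma blinN V W (f : V -> W) u : blin f -> f (- u) = - f u.
Proof. by move=> fb; rewrite -scaleN1r blinZ// scaleN1r. Qed.

Lemma blin_id V : blin (@id V).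
Proof. by split => //; exists 1 => // x; rewrite mul1r. Qed.

Lemma blin_cst0 V W : blin (fun _ : V => 0 : W).
Proof.
split; first by move=> a u v; rewrite scaler0 addr0.
by exists 0 => // x; rewrite mul0r /nsq hdot0l.
Qed.

Lemma blin_comp V W E (f : W -> E) (g : V -> W) :
  blin f -> blin g -> blin (fun x => f (g x)).
Proof.
move=> fb gb; split; first by move=> a u v /=; rewrite (blinP _ _ _ gb) (blinP _ _ _ fb).
have [[_ [M M0 fM]] [_ [N N0 gN]]] := (fb, gb).
exists (M * N); first exact: mulr_ge0.
by move=> x; rewrite (le_trans (fM _))// -mulrA ler_wpM2l.
Qed.

Lemma blin_add V W (f g : V -> W) :
  blin f -> blin g -> blin (fun x => f x + g x).
Proof.
move=> fb gb; split.
  by move=> a u v /=; rewrite (blinP _ _ _ fb) (blinP _ _ _ gb) scalerDr addrACA.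
have [[_ [M M0 fM]] [_ [N N0 gN]]] := (fb, gb).
exists (2 * (M + N)); first by rewrite mulr_ge0// addr_ge0.
move=> x; rewrite (le_trans (nsqD_le _ _ _))// -mulrA ler_wpM2l// mulrDl.
exact: lerD.
Qed.

Lemma blin_scale V W a (f : V -> W) : blin f -> blin (fun x => a *: f x).
Proof.
move=> fb; split; first by move=> b u v /=; rewrite (blinP _ _ _ fb) scalerDr !scalerA mulrC.
have [_ [M M0 fM]] := fb.
have a0 : 0 <= complex.Re (`|a| ^+ 2) by rewrite -add_Re2_Im2/= addr_ge0 ?sqr_ge0.
exists (complex.Re (`|a| ^+ 2) * M); first exact: mulr_ge0.
by move=> x; rewrite nsqZ -mulrA ler_wpM2l.
Qed.

Lemma blin_opp V W (f : V -> W) : blin f -> blin (fun x => - f x).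
Proof.
by move=> /(blin_scale (-1)); congr blin; apply/funext => x; rewrite scaleN1r.
Qed.

Lemma nsq_hsum V W (u : hsum V W) :
  nsq hdot u = nsq hdot u.1 + nsq hdot u.2.
Proof. by rewrite -raddfD. Qed.

Lemma blin_fst V W E (f : V -> hsum W E) : blin f -> blin (fun x => (f x).1).
Proof.
apply: blin_comp; split => //; exists 1 => // x.
by rewrite mul1r nsq_hsum lerDl.
Qed.

Lemma blin_snd V W E (f : V -> hsum W E) : blin f -> blin (fun x => (f x).2).
Proof.
apply: blin_comp; split => //; exists 1 => // x.
by rewrite mul1r nsq_hsum lerDr.
Qed.

Lemma blin_pair V W E (f : V -> W) (g : V -> E) :
  blin f -> blin g -> blin (fun x => (f x, g x) : hsum W E).
Proof.
move=> fb gb; split; first by move=> a u v /=; rewrite (blinP _ _ _ gb) (blinP _ _ _ fb).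
have [[_ [M M0 fM]] [_ [N N0 gN]]] := (fb, gb).
exists (M + N); first exact: addr_ge0.
move=> x; rewrite nsq_hsum [leRHS]mulrDl; apply: lerD; [exact: fM|exact: gN].
Qed.

Lemma hadj_eq V W (T : V -> W) y v :
  (forall x, hdot (T x) y = hdot x v) -> hadj T y = v.
Proof.
move=> Tv; apply: hdot_inj => x; rewrite -Tv; symmetry.
have adjP : [set v | forall x, hdot (T x) y = hdot x v] (hadj T y).
  by apply: xgetPex; exists v.
exact: adjP.
Qed.

Lemma hadjP V W (T : V -> W) x y : blin T -> hdot (T x) y = hdot x (hadj T y).
Proof.
move=> Tb; have [_ [M M0 TM]] := Tb.
have [|||p pE] := @Riesz R V (fun x => hdot (T x) y) _ (M * nsq hdot y).
- by move=> a u v; rewrite blinP// hdotDl hdotZl.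
- exact: mulr_ge0.
- move=> u; rewrite (le_trans (CauchySchwarz_Re _ _ _))//.
  by rewrite mulrAC ler_wpM2r.
by rewrite (hadj_eq pE).
Qed.

Lemma hadjPl V W (T : V -> W) x y : blin T -> hdot (hadj T y) x = hdot y (T x).
Proof. by move=> Tb; rewrite dotC -hadjP// -dotC. Qed.

(** The bound is |T^* y|^4 <= |T T^* y|^2 |y|^2 <= M |T^* y|^2 |y|^2. *)
Lemma blin_hadj V W (T : V -> W) : blin T -> blin (hadj T).
Proof.
move=> Tb; split.
  move=> a u v; apply: hadj_eq => x.
  by rewrite !hdotDr !hdotZr !hadjP.
have [_ [M M0 TM]] := Tb; exists M => // y.
have [->|n0] := eqVneq (nsq hdot (hadj T y)) 0; first exact: mulr_ge0.
have npos : 0 < nsq hdot (hadj T y) by rewrite lt_def n0/=.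
rewrite -(ler_pM2l npos) -expr2 mulrA.
rewrite {1}/nsq -hadjP//; apply: (le_trans (CauchySchwarz_Re _ _ _)).
by rewrite ler_wpM2r// mulrC.
Qed.

End BoundedLinear.

(** * Operators on l^2 *)

Section Ell2Operators.
Variable R : realType.
Implicit Types V E : sepHilbertType R.

(** The junk value 0 is taken outside of l^2.  The definition is locked so that
    unification does not unfold shifts and slotwise operators into each
    other. *)
Definition ell2_mk E : (nat -> E) -> ell2 E := locked (insubd 0).

Lemma ell2_mkE E (x : nat -> E) n : x \in @sqsummable R E -> ell2_mk x n = x n.
Proof. by move=> xs; rewrite /ell2_mk -lock -[LHS]/(val _ n) val_insubd xs. Qed.

Lemma ell2_mkP E (x : nat -> E) C :
  (forall N, series (fun n => nsq hdot (x n)) N <= C) ->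
  (forall n, ell2_mk x n = x n) /\ nsq hdot (ell2_mk x) <= C.
Proof.
move=> xC; have [y yE yC] := ell2_exists xC.
have -> : ell2_mk x = y; last by [].
apply: ell2_ext => n; rewrite ell2_mkE ?yE//.
by rewrite (_ : x = y); [exact: (valP y)|apply/funext => k; rewrite yE].
Qed.

Lemma blin_coord E n : blin (fun x : ell2 E => x n).
Proof.
by split => //; exists 1 => // x; rewrite mul1r; exact: ell2_nsq_coord.
Qed.

(** Together with the slot 0, the two shifts below identify l^2(E) with
    E + l^2(E); see hdot_ell2 and ell2_eta. *)
Definition ell2_behead E (x : ell2 E) := ell2_mk (fun n => x n.+1).

Let series_behead E (x : ell2 E) N :
  series (fun n => nsq hdot (x n.+1)) N <= nsq hdot x.
Proof.
apply: le_trans (ell2_nsq_ge x N.+1); rewrite /series/= big_nat_recl//=.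
by rewrite lerDr.
Qed.

Lemma ell2_beheadE E (x : ell2 E) n : ell2_behead x n = x n.+1.
Proof. by have [->] := ell2_mkP (series_behead x). Qed.

Lemma blin_behead E : blin (@ell2_behead E).
Proof.
split; first by move=> a u v; apply: ell2_ext => n; rewrite ell2_linE !ell2_beheadE.
by exists 1 => // x; rewrite mul1r; have [] := ell2_mkP (series_behead x).
Qed.

Definition ell2_cons E (l : E) (x : ell2 E) :=
  ell2_mk (fun n => if n is n'.+1 then x n' else l).

Let series_cons E (l : E) (x : ell2 E) N :
  series (fun n => nsq hdot (if n is n'.+1 then x n' else l)) N <=
  nsq hdot l + nsq hdot x.
Proof.
case: N => [|N]; first by rewrite /series/= big_geq ?addr_ge0.
by rewrite /series/= big_nat_recl//= lerD2l; exact: ell2_nsq_ge.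
Qed.

Lemma ell2_cons0 E (l : E) x : ell2_cons l x 0%N = l.
Proof. by have [->] := ell2_mkP (series_cons l x). Qed.

Lemma ell2_consS E (l : E) x n : ell2_cons l x n.+1 = x n.
Proof. by have [->] := ell2_mkP (series_cons l x). Qed.

Lemma ell2_consK E (l : E) x : ell2_behead (ell2_cons l x) = x.
Proof. by apply: ell2_ext => n; rewrite ell2_beheadE ell2_consS. Qed.

Lemma ell2_eta E (x : ell2 E) : ell2_cons (x 0%N) (ell2_behead x) = x.
Proof.
by apply: ell2_ext => -[|n]; rewrite ?ell2_cons0// ell2_consS ell2_beheadE.
Qed.

Lemma blin_cons V E (f : V -> E) (g : V -> ell2 E) :
  blin f -> blin g -> blin (fun x => ell2_cons (f x) (g x)).
Proof.
move=> fb gb; split.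
  move=> a u v; apply: ell2_ext => -[|n]; rewrite ell2_linE ?ell2_cons0 ?ell2_consS.
    exact: blinP.
  by rewrite blinP.
have [[_ [M M0 fM]] [_ [N N0 gN]]] := (fb, gb).
exists (M + N); first exact: addr_ge0.
move=> x; have [_ /le_trans] := ell2_mkP (series_cons (f x) (g x)); apply.
by rewrite mulrDl lerD.
Qed.

Lemma hdot_ell2 E (x y : ell2 E) :
  hdot x y = hdot (x 0%N) (y 0%N) + hdot (ell2_behead x) (ell2_behead y).
Proof.
rewrite !hdot_ell2E; have [_ ->] := csum_shift (dot_summable x y).
by congr (_ + csum _); apply/funext => n /=; rewrite !ell2_beheadE.
Qed.

Definition ell2_map (E E' : sepHilbertType R) (T : nat -> E -> E') (x : ell2 E) :=
  ell2_mk (fun n => T n (x n)).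

Section Map.
Variables (E E' : sepHilbertType R) (T : nat -> E -> E') (M : R).
Hypothesis M0 : 0 <= M.
Hypothesis T_lin : forall n, linear (T n).
Hypothesis T_bnd : forall n v, nsq hdot (T n v) <= M * nsq hdot v.

Let series_map (x : ell2 E) N :
  series (fun n => nsq hdot (T n (x n))) N <= M * nsq hdot x.
Proof.
apply: (@le_trans _ _ (M * series (fun n => nsq hdot (x n)) N)).
  by rewrite /series/= mulr_sumr; apply: ler_sum.
by rewrite ler_wpM2l//; exact: ell2_nsq_ge.
Qed.

Lemma ell2_mapE (x : ell2 E) n : ell2_map T x n = T n (x n).
Proof. by have [->] := ell2_mkP (series_map x). Qed.

Lemma blin_map : blin (ell2_map T).
Proof.
split; first by move=> a u v; apply: ell2_ext => n; rewrite ell2_linE !ell2_mapE T_lin.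
by exists M => // x; have [] := ell2_mkP (series_map x).
Qed.
End Map.

Section Stack.
Variables (V E : sepHilbertType R) (N : nat) (T : 'I_N -> {bounded V -> E}).

(** The operators T k are stacked into the first N slots of l^2(E), which thus
    plays the role of the direct sum of N copies of E. *)
Definition stack_seq (x : V) (n : nat) : E :=
  if insub n is Some k then T k x else 0.
Definition stack (x : V) : ell2 E := ell2_mk (stack_seq x).

Let stack_seq_fin (x : V) n : (N <= n)%N -> stack_seq x n = 0.
Proof. by move=> Nn; rewrite /stack_seq insubN// -leqNgt. Qed.

Let stack_seq_ord (x : V) (k : 'I_N) : stack_seq x k = T k x.
Proof. by rewrite /stack_seq insubT//= => kN; congr (T _ _); exact: val_inj. Qed.

Let series_stack (x : V) n :
  series (fun n => nsq hdot (stack_seq x n)) n <= \sum_(k < N) nsq hdot (T k x).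
Proof.
apply: (@le_trans _ _ (series (fun n => nsq hdot (stack_seq x n)) (N + n)%N)).
  rewrite /series/= [leRHS](big_cat_nat (n := n)) ?leq_addl//= lerDl.
  by rewrite sumr_ge0.
rewrite /series/= (big_cat_nat (n := N)) ?leq_addr//= big_mkord.
rewrite [X in _ + X]big_nat_cond [X in _ + X]big1 ?addr0.
  by apply: ler_sum => k _; rewrite stack_seq_ord.
by move=> i /andP[/andP[Ni _] _]; rewrite stack_seq_fin// /nsq hdot0l.
Qed.

Lemma blin_stack : blin stack.
Proof.
have sE x n : stack x n = stack_seq x n by have [->] := ell2_mkP (series_stack x).
split.
  move=> a u v; apply: ell2_ext => n; rewrite ell2_linE !sE /stack_seq.
  by case: insub => [k|]; rewrite ?linearP// scaler0 addr0.
have /choice[M MP] : forall k, exists M : R, 0 <= M /\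
    forall x, nsq hdot (T k x) <= M * nsq hdot x.
  by move=> k; have [_ [M ? ?]] := blin_bounded (T k); exists M.
exists (\sum_(k < N) M k); first by rewrite sumr_ge0// => k _; case: (MP k).
move=> x; have [_ /le_trans] := ell2_mkP (series_stack x); apply.
by rewrite mulr_suml ler_sum// => k _; case: (MP k).
Qed.

Lemma stack_ord (x : V) (k : 'I_N) : stack x k = T k x.
Proof. by have [-> _] := ell2_mkP (series_stack x); rewrite stack_seq_ord. Qed.

Lemma hdot_stack (f : ell2 E) (y : V) :
  hdot f (stack y) = \sum_(k < N) hdot (f k) (T k y).
Proof.
rewrite hdot_ell2E; have [|_ ->] := @csum_fin R (fun n => hdot (f n) (stack y n)) N.
  move=> n Nn; have [-> _] := ell2_mkP (series_stack y).
  by rewrite stack_seq_fin// hdot0r.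
by apply: eq_bigr => k _; rewrite stack_ord.
Qed.
End Stack.
End Ell2Operators.

(** * J-unitary operators and shears *)

Section KreinUnitary.
Variable R : realType.

Definition krein_unitary (V W : sepHilbertType R) (J1 : V -> V) (J2 : W -> W)
    (G : V -> W) :=
  (forall u v, hdot (J2 (G u)) (G v) = hdot (J1 u) v) /\
  (forall y, exists x, G x = y).

Lemma krein_unitary_comp (V W E : sepHilbertType R) (J1 : V -> V) (J2 : W -> W)
    (J3 : E -> E) (G : V -> W) (H : W -> E) :
  krein_unitary J1 J2 G -> krein_unitary J2 J3 H ->
  krein_unitary J1 J3 (fun x => H (G x)).
Proof.
move=> [G1 G2] [H1 H2]; split; first by move=> u v; rewrite H1 G1.
by move=> y; have [w <-] := H2 y; have [x <-] := G2 w; exists x.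
Qed.

(** Preservation of the form says that J1 u represents x |-> <G x, J2 G u>, that
    is, G^* (J2 G u) = J1 u; since G is onto, every vector is of the form
    J2 G u, and this determines G^* completely. *)
Lemma krein_unitary_hadj (V W : sepHilbertType R) (J1 : V -> V) (J2 : W -> W)
    (G : V -> W) : involutive J1 -> involutive J2 -> krein_unitary J1 J2 G ->
  hadj G \o J2 \o G = J1 /\ G \o J1 \o hadj G = J2.
Proof.
move=> J1K J2K [GJ Gsurj].
have adjE u : hadj G (J2 (G u)) = J1 u.
  by apply: hadj_eq => x; rewrite dotC GJ -dotC.
split; apply/funext => y /=; first exact: adjE.
by have [u uE] := Gsurj (J2 y); rewrite -{1}[y]J2K -uE adjE J1K.
Qed.

End KreinUnitary.

Section Shear.
Variables (R : realType) (H F : sepHilbertType R) (T : H -> F).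
Hypothesis Tb : blin T.
Local Notation K := (hsum H (hsum F F)).

Definition swap (V : sepHilbertType R) (u : hsum V V) : hsum V V := (u.2, u.1).

(** The two copies of F are isotropic subspaces, paired with each other. *)
Definition hyp_sym : K -> K := hsum_op idfun (@swap F).

(** The half compensates a quadratic term: the first component contributes
    <T^* f, T^* f>, and the subtracted half of T T^* f is counted twice in
    <f, g> + <g, f>. *)
Definition shear (u : K) : K :=
  (u.1 - hadj T u.2.1,
   (u.2.1, u.2.2 + T u.1 - 2^-1 *: T (hadj T u.2.1))).

Definition unshear (u : K) : K :=
  (u.1 + hadj T u.2.1,
   (u.2.1, u.2.2 - T u.1 - 2^-1 *: T (hadj T u.2.1))).

Let halfK (v : F) : v - 2^-1 *: v - 2^-1 *: v = 0.
Proof.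
rewrite -addrA -opprD -scalerDl -{1}[v]scale1r -scalerBl.
by rewrite (_ : _ - _ = 0) ?scale0r//; field.
Qed.

Lemma shearK : cancel shear unshear.
Proof.
move=> [h [f g]]; rewrite /unshear /shear/= subrK; congr (_, (_, _)).
rewrite (blinD _ _ Tb) (blinN _ Tb) opprD opprK.
rewrite (_ : _ - _ =
  g + (T (hadj T f) - 2^-1 *: T (hadj T f) - 2^-1 *: T (hadj T f))).
  by rewrite halfK addr0.
rewrite [g + _ - _]addrAC [- _ + _]addrC addrA [_ + T h + _]addrAC addrK.
by rewrite -!addrA; congr (_ + _); rewrite addrCA.
Qed.

Lemma unshearK : cancel unshear shear.
Proof.
move=> [h [f g]]; rewrite /unshear /shear/= addrK; congr (_, (_, _)).
rewrite (blinD _ _ Tb).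
rewrite (_ : _ - _ =
  g + (T (hadj T f) - 2^-1 *: T (hadj T f) - 2^-1 *: T (hadj T f))).
  by rewrite halfK addr0.
rewrite [g - _ - _]addrAC addrA subrK.
by rewrite -!addrA; congr (_ + _); rewrite addrCA.
Qed.

Lemma shear_form u v : hdot (hyp_sym (shear u)) (shear v) = hdot (hyp_sym u) v.
Proof.
move: u v => [h [f g]] [h' [f' g']].
rewrite !hdot_hsumE/=.
rewrite !(hdotBl, hdotBr, hdotDl, hdotDr, hdotZl, hdotZr) fmorphV/= conjC_nat.
rewrite !(hadjP _ _ Tb) !(hadjPl _ _ Tb) -!(hadjPl _ _ Tb).
by field.
Qed.

Lemma unshear_form u v :
  hdot (hyp_sym (unshear u)) (unshear v) = hdot (hyp_sym u) v.
Proof. by rewrite -shear_form !unshearK. Qed.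

Lemma blin_shear : blin shear.
Proof.
have b1 : blin (fun u : K => u.1) by exact/blin_fst/blin_id.
have b2 : blin (fun u : K => u.2.1) by exact/blin_fst/blin_snd/blin_id.
have b3 : blin (fun u : K => u.2.2) by exact/blin_snd/blin_snd/blin_id.
have b4 : blin (fun u : K => hadj T u.2.1) by exact: blin_comp (blin_hadj Tb) b2.
apply: blin_pair; first exact: blin_add b1 (blin_opp b4).
apply: blin_pair => //; apply: blin_add.
  exact: blin_add b3 (blin_comp Tb b1).
exact/blin_opp/blin_scale/(blin_comp Tb b4).
Qed.

Lemma blin_unshear : blin unshear.
Proof.
have b1 : blin (fun u : K => u.1) by exact/blin_fst/blin_id.
have b2 : blin (fun u : K => u.2.1) by exact/blin_fst/blin_snd/blin_id.
have b3 : blin (fun u : K => u.2.2) by exact/blin_snd/blin_snd/blin_id.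
have b4 : blin (fun u : K => hadj T u.2.1) by exact: blin_comp (blin_hadj Tb) b2.
apply: blin_pair; first exact: blin_add b1 b4.
apply: blin_pair => //; apply: blin_add.
  exact: blin_add b3 (blin_opp (blin_comp Tb b1)).
exact/blin_opp/blin_scale/(blin_comp Tb b4).
Qed.

Lemma hyp_symK : involutive hyp_sym.
Proof. by move=> [? []]. Qed.

Lemma hyp_sym_adj u v : hdot (hyp_sym u) v = hdot u (hyp_sym v).
Proof. by rewrite !hdot_hsumE/= [X in _ + X = _]addrC. Qed.

Lemma hyp_sym_lin : linear hyp_sym.
Proof. by move=> a u v; congr (_, (_, _)). Qed.

Lemma nsq_hyp_sym u : nsq hdot (hyp_sym u) = nsq hdot u.
Proof. by rewrite !nsq_hsum/= [X in _ + X = _]addrC. Qed.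

End Shear.

(** * Slotwise operators *)

(** Reduces a goal that follows linearly from p = q to a polynomial identity. *)
Lemma eq_of_subr_eq (V : zmodType) (a b p q : V) :
  p = q -> a - p = b - q -> a = b.
Proof. by move=> -> /addIr. Qed.

Section Pointwise.
Variables (R : realType) (E E' : sepHilbertType R).
Local Notation KE := (hsum E (hsum E' E')).

Definition hyp_sym_seq (x : ell2 KE) : ell2 KE := ell2_map (fun=> @hyp_sym R E E') x.

Let sym_lin (k : nat) : linear ((fun=> @hyp_sym R E E') k : KE -> KE).
Proof. exact: hyp_sym_lin. Qed.

Let sym_bnd (k : nat) (v : KE) : nsq hdot ((fun=> @hyp_sym R E E') k v) <= 1 * nsq hdot v.
Proof. by rewrite mul1r nsq_hyp_sym. Qed.

Lemma hyp_sym_seqE x k : hyp_sym_seq x k = hyp_sym (x k).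
Proof. exact: (ell2_mapE (@ler01 R) sym_bnd). Qed.

Lemma blin_hyp_sym_seq : blin hyp_sym_seq.
Proof. exact: (blin_map (@ler01 R) sym_lin sym_bnd). Qed.

Lemma hyp_sym_seqK : involutive hyp_sym_seq.
Proof. by move=> x; apply: ell2_ext => k; rewrite !hyp_sym_seqE hyp_symK. Qed.

Lemma hyp_sym_seq_adj x y : hdot (hyp_sym_seq x) y = hdot x (hyp_sym_seq y).
Proof.
rewrite !hdot_ell2E; congr csum; apply/funext => k.
by rewrite !hyp_sym_seqE hyp_sym_adj.
Qed.

Lemma hdot_hyp_sym_seq x y : hdot (hyp_sym_seq x) y =
  hdot (hyp_sym (x 0%N)) (y 0%N) + hdot (hyp_sym_seq (ell2_behead x)) (ell2_behead y).
Proof.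
have -> : hyp_sym_seq (ell2_behead x) = ell2_behead (hyp_sym_seq x).
  by apply: ell2_ext => k; rewrite ell2_beheadE !hyp_sym_seqE ell2_beheadE.
by rewrite -hyp_sym_seqE; exact: hdot_ell2.
Qed.
End Pointwise.

Section SlotMultiplier.
Variables (R : realType) (n : nat) (E : sepHilbertType R).
Implicit Types z : 'rV[R[i]]_n.+1.

(** The operator Z(z).  Since inord sends every number above n to ord0, the
    slots beyond the last one are multiplied by z_0, so that Z(z) is unitary on
    the torus. *)
Definition slot_mul z (f : ell2 E) : ell2 E :=
  ell2_map (fun k v => z 0 (inord k) *: v) f.

Let slot_bnd z k (v : E) : nsq hdot (z 0 (inord k) *: v) <=
  (\sum_i complex.Re (`|z 0 i| ^+ 2)) * nsq hdot v.
Proof.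
have ge0 (i : 'I_n.+1) : 0 <= complex.Re (`|z 0 i| ^+ 2).
  by rewrite -add_Re2_Im2/= addr_ge0 ?sqr_ge0.
rewrite nsqZ ler_wpM2r// (bigD1 (inord k))//= lerDl.
by apply: sumr_ge0 => i _; exact: ge0.
Qed.

Let sum_ge0 z : 0 <= \sum_i complex.Re (`|z 0 i| ^+ 2).
Proof.
by rewrite sumr_ge0// => i _; rewrite -add_Re2_Im2/= addr_ge0 ?sqr_ge0.
Qed.

Let slot_lin z k : linear (fun v : E => z 0 (inord k) *: v).
Proof. by move=> a u v; rewrite scalerDr !scalerA mulrC. Qed.

Lemma slot_mulE z f k : slot_mul z f k = z 0 (inord k) *: f k.
Proof. exact: (ell2_mapE (sum_ge0 z) (slot_bnd z)). Qed.

Lemma blin_slot_mul z : blin (slot_mul z).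
Proof. exact: (blin_map (sum_ge0 z) (slot_lin z) (slot_bnd z)). Qed.

Lemma slot_mulD a z w f : slot_mul (a *: z + w) f = a *: slot_mul z f + slot_mul w f.
Proof.
apply: ell2_ext => k; rewrite ell2_linE !slot_mulE !mxE.
by rewrite scalerDl scalerA.
Qed.

Definition unimodular z := forall k, `|z 0 k| = 1.

Lemma slot_mul_dot z f g : unimodular z ->
  hdot (slot_mul z f) (slot_mul z g) = hdot f g.
Proof.
move=> z1; rewrite !hdot_ell2E; congr csum; apply/funext => k.
by rewrite !slot_mulE hdotZl hdotZr mulrA -normCK z1 expr1n mul1r.
Qed.

Lemma slot_mul_surj z g : unimodular z -> exists f, slot_mul z f = g.
Proof.
move=> z1; exists (slot_mul (map_mx conjC z) g).
apply: ell2_ext => k; rewrite !slot_mulE mxE scalerA -normCK z1 expr1n.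
by rewrite scale1r.
Qed.
End SlotMultiplier.

(** * The J-unitary colligation *)

(** The indices 0 .. n and the space F = l^2(H') are abstracted into Z : F -> F
    and c = z_0; all the components other than F carry the index 0. *)
Section Colligation.
Variables (R : realType) (X U Y F : sepHilbertType R).
(** The iterated sums get names: comparing canonical structures of deeply
    nested sums by unfolding would be exponential. *)
Definition inflow : sepHilbertType R := hsum X U.
Definition outflow : sepHilbertType R := hsum X Y.
Definition hyperbolic : sepHilbertType R := hsum F F.
Definition past_slot : sepHilbertType R := hsum inflow hyperbolic.
Definition future_slot : sepHilbertType R := hsum outflow hyperbolic.
Definition past : sepHilbertType R := ell2 past_slot.
Definition future : sepHilbertType R := ell2 future_slot.
Definition past_now : sepHilbertType R := hsum past X.
Definition dilation_space : sepHilbertType R := hsum past_now future.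
Definition dilation_in : sepHilbertType R := hsum dilation_space U.
Definition dilation_out : sepHilbertType R := hsum dilation_space Y.
Definition delays : sepHilbertType R := hsum past future.
Definition flow_spaces : sepHilbertType R := hsum inflow outflow.
Definition core_space : sepHilbertType R := hsum flow_spaces hyperbolic.
Definition weighed_space : sepHilbertType R := hsum delays core_space.

Variables (Gamma : inflow -> F) (Delta : outflow -> F).
Hypotheses (GammaB : blin Gamma) (DeltaB : blin Delta).

(** The factor W: the slot 0 of the future is read, and its hyperbolic part
    meets the inflow in the shear of Gamma. *)
Definition inlet (u : dilation_in) : weighed_space :=
  let w := shear Gamma ((u.1.1.2, u.2), (u.1.2 0%N).2) in
  ((u.1.1.1, ell2_behead u.1.2), ((w.1, (u.1.2 0%N).1), w.2)).

Definition weigh (c : R[i]) (Z : F -> F) (k : weighed_space) : weighed_space :=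
  (c *: k.1, (c *: k.2.1, (Z k.2.2.1, Z k.2.2.2))).

(** The factor V.  The two copies of F are exchanged before the inverse shear of
    Delta, because Gamma lands in the second copy whereas the adjoint of Delta
    reads the first one. *)
Definition outlet (k : weighed_space) : dilation_out :=
  let v := unshear Delta (k.2.1.2, swap k.2.2) in
  (((ell2_cons ((k.2.1.1, swap v.2) : past_slot) k.1.1, v.1.1), k.1.2), v.1.2).

(** J is the identity on X and exchanges the copies of F in all the slots of the
    past and of the future. *)
Definition Jt (x : dilation_space) : dilation_space :=
  ((hyp_sym_seq x.1.1, x.1.2), hyp_sym_seq x.2).

Definition Jin (u : dilation_in) : dilation_in := (Jt u.1, u.2).
Definition Jout (u : dilation_out) : dilation_out := (Jt u.1, u.2).

Definition Jweighed (k : weighed_space) : weighed_space :=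
  ((hyp_sym_seq k.1.1, hyp_sym_seq k.1.2), (k.2.1, swap k.2.2)).

Lemma inlet_unitary : krein_unitary Jin Jweighed inlet.
Proof.
split.
  move=> [[[d x] s] u] [[[d' x'] s'] u'].
  rewrite !hdot_hsumE/= [in RHS](hdot_hyp_sym_seq s)/=.
  have := shear_form GammaB ((x, u), (s 0%N).2) ((x', u'), (s' 0%N).2).
  rewrite !hdot_hsumE/= => h.
  by apply: (eq_of_subr_eq h); ring.
move=> [[d s] [[a b] f]].
have [[h1 f1] hE] : exists h, shear Gamma h = (a, f).
  by exists (unshear Gamma (a, f)); exact: unshearK.
exists (((d, h1.1), ell2_cons ((b, f1) : future_slot) s), h1.2).
case: h1 hE => x u hE; rewrite /inlet; cbn zeta; cbn [fst snd].
by rewrite ell2_consK !ell2_cons0; cbn [fst snd]; rewrite hE.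
Qed.

Lemma weigh_unitary (c : R[i]) (Z : F -> F) : `|c| = 1 ->
  (forall f g, hdot (Z f) (Z g) = hdot f g) -> (forall g, exists f, Z f = g) ->
  krein_unitary Jweighed Jweighed (weigh c Z).
Proof.
move=> c1 Ziso Zsurj.
have cc : c * conjC c = 1 by rewrite -normCK c1 expr1n.
have JweighedE k k' : hdot (Jweighed k) k' =
    hdot (hyp_sym_seq k.1.1) k'.1.1 + hdot (hyp_sym_seq k.1.2) k'.1.2 +
    (hdot k.2.1 k'.2.1 + (hdot k.2.2.2 k'.2.2.1 + hdot k.2.2.1 k'.2.2.2)).
  by [].
have hypZ (E E' : sepHilbertType R) (v w : ell2 (hsum E (hsum E' E'))) :
    hdot (hyp_sym_seq (c *: v)) (c *: w) = hdot (hyp_sym_seq v) w.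
  by rewrite (blinZ _ _ (@blin_hyp_sym_seq _ _ _)) hdotZl hdotZr mulrA cc mul1r.
split.
  move=> k k'; rewrite !JweighedE /weigh.
  cbn [fst snd]; rewrite !Ziso hdotZl hdotZr mulrA cc mul1r.
  by congr (_ + _ + _); exact: hypZ.
move=> [k1 [k2 [f g]]].
have [[f1 <-] [g1 <-]] := (Zsurj f, Zsurj g).
exists (conjC c *: k1, (conjC c *: k2, (f1, g1))).
by rewrite /weigh; cbn [fst snd]; rewrite !scalerA cc !scale1r.
Qed.

Lemma outlet_unitary : krein_unitary Jweighed Jout outlet.
Proof.
split.
  move=> [[d s] [[a b] [f g]]] [[d' s'] [[a' b'] [f' g']]].
  rewrite !hdot_hsumE/= hdot_hyp_sym_seq !ell2_cons0 !ell2_consK/=.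
  have := unshear_form DeltaB (b, (g, f)) (b', (g', f')).
  rewrite !hdot_hsumE/= => h.
  by apply: (eq_of_subr_eq h); ring.
move=> [[[e x] s] y].
pose v : future_slot := ((x, y), swap (e 0%N).2).
have [[b [g f]] bE] : exists k, unshear Delta k = v.
  by exists (shear Delta v); exact: shearK.
exists ((ell2_behead e, s), (((e 0%N).1, b), (f, g))).
have eE : ell2_cons (((e 0%N).1, swap v.2) : past_slot) (ell2_behead e) = e.
  by rewrite -[RHS]ell2_eta /v; case: (e 0%N) => ? [].
rewrite /outlet; cbn zeta; cbn [fst snd].
by rewrite (_ : unshear Delta (b, swap (f, g)) = v)// eE.
Qed.

Definition colligation (c : R[i]) (Z : F -> F) (u : dilation_in) : dilation_out :=
  outlet (weigh c Z (inlet u)).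

Lemma colligation_unitary (c : R[i]) (Z : F -> F) : `|c| = 1 ->
  (forall f g, hdot (Z f) (Z g) = hdot f g) -> (forall g, exists f, Z f = g) ->
  krein_unitary Jin Jout (colligation c Z).
Proof.
move=> c1 Ziso Zsurj.
have iw := krein_unitary_comp inlet_unitary (weigh_unitary c1 Ziso Zsurj).
exact: krein_unitary_comp iw outlet_unitary.
Qed.

Lemma blin_inlet : blin inlet.
Proof.
have bid := blin_id dilation_in.
have bs : blin (fun u : dilation_in => u.1.2) by exact/blin_snd/blin_fst.
have b0 : blin (fun u : dilation_in => u.1.2 0%N).
  exact: (blin_comp (blin_coord _ 0) bs).
have bw : blin (fun u : dilation_in => shear Gamma ((u.1.1.2, u.2), (u.1.2 0%N).2)).
  apply: (blin_comp (blin_shear GammaB)); apply: blin_pair; last exact: (blin_snd b0).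
  by apply: blin_pair; [exact/blin_snd/blin_fst/blin_fst|exact/blin_snd].
apply: blin_pair.
  apply: blin_pair; first exact/blin_fst/blin_fst/blin_fst.
  exact: (blin_comp (blin_behead _) bs).
apply: blin_pair; last exact: (blin_snd bw).
by apply: blin_pair; [exact: (blin_fst bw)|exact: (blin_fst b0)].
Qed.

Lemma blin_weigh c Z : blin Z -> blin (weigh c Z).
Proof.
move=> Zb; have bid := blin_id weighed_space.
apply: blin_pair; first exact/blin_scale/blin_fst.
apply: blin_pair; first exact/blin_scale/blin_fst/blin_snd.
by apply: blin_pair; apply: (blin_comp Zb);
  [exact/blin_fst/blin_snd/blin_snd|exact/blin_snd/blin_snd/blin_snd].
Qed.

Lemma blin_outlet : blin outlet.
Proof.
have bid := blin_id weighed_space.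
have bv : blin (fun k : weighed_space => unshear Delta (k.2.1.2, swap k.2.2)).
  apply: (blin_comp (blin_unshear DeltaB)); apply: blin_pair.
    exact/blin_snd/blin_fst/blin_snd.
  by apply: blin_pair; [exact/blin_snd/blin_snd/blin_snd|exact/blin_fst/blin_snd/blin_snd].
apply: blin_pair; last exact: (blin_snd (blin_fst bv)).
apply: blin_pair; last exact/blin_snd/blin_fst.
apply: blin_pair; last exact: (blin_fst (blin_fst bv)).
apply: blin_cons; last exact/blin_fst/blin_fst.
apply: blin_pair; first exact/blin_fst/blin_fst/blin_snd.
by apply: blin_pair; [exact: (blin_snd (blin_snd bv))|exact: (blin_fst (blin_snd bv))].
Qed.

Lemma blin_colligation c Z : blin Z -> blin (colligation c Z).
Proof.
move=> Zb; apply: (blin_comp blin_outlet).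
exact: (blin_comp (blin_weigh _ Zb) blin_inlet).
Qed.

Lemma colligation_lin (a c c' : R[i]) (Z Z' Z2 : F -> F) u :
  (forall f, Z2 f = a *: Z f + Z' f) ->
  colligation (a * c + c') Z2 u = a *: colligation c Z u + colligation c' Z' u.
Proof.
move=> Z2E; rewrite /colligation -(blinP _ _ _ blin_outlet); congr outlet.
by rewrite /weigh !Z2E !scalerDl -!scalerA.
Qed.

(** Whatever is already in the past only moves further away. *)
Lemma colligation_past c Z d : blin Z ->
  colligation c Z (((d, 0), 0), 0) = (((ell2_cons 0 (c *: d), 0), 0), 0).
Proof.
move=> Zb; rewrite /colligation.
have -> : inlet (((d, 0), 0), 0) = ((d, 0), 0).
  rewrite /inlet; cbn zeta; cbn [fst snd].
  by rewrite (blin0 (blin_behead _)) (blin0 (blin_shear GammaB)).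
have -> : weigh c Z ((d, 0), 0) = ((c *: d, 0), 0).
  rewrite /weigh; cbn [fst snd]; rewrite !(blin0 Zb) scaler0.
  by congr (_, _); congr (_, _); exact: scaler0.
by rewrite /outlet; cbn zeta; cbn [fst snd]; rewrite (blin0 (blin_unshear DeltaB)).
Qed.

(** With an empty future the shear of Gamma sends (x, u) to
    (x, u, 0, Gamma (x, u)), and the inverse shear of Delta adds Delta^* Z Gamma (x, u) to a zero
    outflow. *)
Lemma colligation_flow c Z x u : blin Z ->
  let v := colligation c Z (((0, x), 0), u) in
  (v.1.1.2, v.2) = hadj Delta (Z (Gamma (x, u))) :> outflow.
Proof.
move=> Zb v; rewrite {}/v /colligation.
pose w : past_slot := shear Gamma ((x, u), 0).
have wE : w.2 = (0, Gamma (x, u)).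
  rewrite /w /shear; cbn [fst snd].
  by rewrite (blin0 (blin_hadj GammaB)) (blin0 GammaB) scaler0 subr0 add0r.
have -> : inlet (((0, x), 0), u) = ((0, 0), ((w.1, 0), w.2)).
  by rewrite /inlet; cbn zeta; cbn [fst snd]; rewrite (blin0 (blin_behead _)).
rewrite /weigh; cbn [fst snd]; rewrite wE; cbn [fst snd]; rewrite (blin0 Zb).
rewrite /outlet; cbn zeta; cbn [fst snd]; rewrite -surjective_pairing.
rewrite /unshear; cbn [fst snd].
by rewrite [LHS](_ : _ = c *: 0 + hadj Delta (Z (Gamma (x, u))))// scaler0 add0r.
Qed.

Lemma Jt_adj x y : hdot (Jt x) y = hdot x (Jt y).
Proof.
by rewrite !hdot_hsumE; congr (_ + _ + _); exact: hyp_sym_seq_adj.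
Qed.

Lemma JtK : involutive Jt.
Proof. by move=> [[d x] s]; rewrite /Jt/= !hyp_sym_seqK. Qed.

Lemma blin_Jt : blin Jt.
Proof.
have bid := blin_id dilation_space.
apply: blin_pair; last exact: (blin_comp (@blin_hyp_sym_seq _ _ _) (blin_snd bid)).
apply: blin_pair; last exact/blin_snd/blin_fst.
exact: (blin_comp (@blin_hyp_sym_seq _ _ _) (blin_fst (blin_fst bid))).
Qed.
End Colligation.

(** * Kernels, projections and pencils *)

Lemma closed_subspace_ker (R : realType) (V W : sepHilbertType R) (f : V -> W) :
  blin f -> closed_subspace [set x | f x = 0].
Proof.
move=> fb; split; last 2 first.
- by rewrite /= blin0.
- by move=> a u v /= fu fv; rewrite blinP// fu fv scaler0 addr0.
move=> x xcl /=; apply/eqP; rewrite -(nsq_eq0 hdot) eq_le nsq_ge0 andbT.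
have [_ [M M0 fM]] := fb.
apply/ler_addgt0Pl => e e0; rewrite addr0.
have M1 : 0 < M + 1 by rewrite ltr_wpDl.
have s0 : 0 < Num.sqrt (e / (M + 1)) by rewrite sqrtr_gt0 divr_gt0.
have [|y [/= fy]] := xcl (ball x (Num.sqrt (e / (M + 1)))%:C).
  by apply: nbhsx_ballx; rewrite ltcR.
rewrite -ball_normE/= norm_ltC; last exact: ltW.
rewrite sqr_sqrtr; last by rewrite divr_ge0 ?(ltW e0) ?(ltW M1).
move=> /ltW xy.
have -> : f x = f (x - y) by rewrite (blinD _ _ fb) (blinN _ fb) fy subr0.
apply: (le_trans (fM _)); apply: (le_trans (ler_wpM2l M0 xy)).
by rewrite mulrCA; apply: ler_piMr; rewrite ?(ltW e0)// ler_pdivrMr// mul1r lerDl.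
Qed.

Lemma hproj_eq (R : realType) (V W : sepHilbertType R) (f : W -> V) (x : V) w :
  blin f -> (forall m, hdot (x - f w) (f m) = 0) -> hproj (range f) x = f w.
Proof.
move=> fb xw.
pose P : set V := [set p | range f p /\ forall m, range f m -> hdot (x - p) m = 0].
have [[w' _ w'E] px] : P (hproj (range f) x).
  by apply: xgetPex; exists (f w); split; [exists w|move=> _ [m _ <-]].
apply/eqP; rewrite -subr_eq0 -(dnorm_eq0 (@hdot R V)) -w'E.
rewrite -{2}(blinN _ fb) -(blinD _ _ fb).
rewrite (_ : f w' - f w = (x - f w) - (x - f w')); last first.
  by rewrite opprB [RHS]addrC addrA subrK.
by rewrite hdotBl xw w'E px ?subr0//; exists (w' - w).
Qed.

Section Pencil.
Variables (R : realType) (n : nat) (V W : sepHilbertType R).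
Implicit Types (T : 'I_n -> {bounded V -> W}) (z : 'rV[R[i]]_n).

Lemma pencil_linear_family T (g : 'rV[R[i]]_n -> V -> W) z :
  (forall a z w x, g (a *: z + w) x = a *: g z x + g w x) ->
  (forall k x, T k x = g (delta_mx 0 k) x) -> pencil z T = g z.
Proof.
move=> glin TE; apply/funext => x; rewrite [in RHS](row_sum_delta z) /pencil.
have g0 : g 0 x = 0.
  by have := glin (-1) 0 0 x; rewrite scaler0 addr0 scaleN1r addNr.
elim: (index_enum _) => [|k r IHr]; first by rewrite !big_nil g0.
by rewrite !big_cons glin IHr TE.
Qed.

Lemma pencil_delta T k : pencil (delta_mx 0 k) T = T k.
Proof.
apply/funext => x; rewrite /pencil (bigD1 k)//= big1 ?addr0.
  by rewrite mxE !eqxx scale1r.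
by move=> i ik; rewrite mxE (negPf ik) andbF scale0r.
Qed.

End Pencil.

(** * The dilation *)

Section Dilation.
Variables (R : realType) (n : nat) (X U Y : sepHilbertType R).
Variable alpha : system n.+1 X U Y.
Implicit Types z : 'rV[R[i]]_n.+1.

Let F : sepHilbertType R := ell2 (outflow X Y).
Let Gamma : inflow X U -> F := stack (sysG alpha).
Let Delta : outflow X Y -> F :=
  stack (fun _ : 'I_n.+1 => to_bounded (@blin_id R (outflow X Y))).
Let GammaB : blin Gamma. Proof. exact: blin_stack. Qed.
Let DeltaB : blin Delta. Proof. exact: blin_stack. Qed.
Let Xt := dilation_space X U Y F.

Let G z : dilation_in X U Y F -> dilation_out X U Y F :=
  colligation Gamma Delta (z 0 ord0) (slot_mul z).

Let blin_G z : blin (G z).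
Proof. by apply: (blin_colligation GammaB DeltaB); exact: blin_slot_mul. Qed.

Let G_lin a z w u : G (a *: z + w) u = a *: G z u + G w u.
Proof.
by rewrite /G !mxE; apply: (colligation_lin _ DeltaB) => f; exact: slot_mulD.
Qed.

Let compression z h : hadj Delta (slot_mul z (Gamma h)) = pencil z (sysG alpha) h.
Proof.
apply: hadj_eq => y; rewrite dotC hdot_stack rmorph_sum linear_sumr/=.
apply: eq_bigr => k _; rewrite -dotC slot_mulE inord_val.
by rewrite /Gamma stack_ord.
Qed.

Let G_flow z x u : let v := G z (((0, x), 0), u) in
  (v.1.1.2, v.2) = pencil z (sysG alpha) (x, u) :> hsum X Y.
Proof.
move=> v; transitivity (hadj Delta (slot_mul z (Gamma (x, u)))); last exact: compression.
have h := colligation_flow Delta GammaB (z 0 ord0) x u (blin_slot_mul _ z).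
exact: h.
Qed.

(** The feedthrough operators of the dilation are literally those of alpha, as
    the outflow of the state 0 comes from G(z) alone. *)
Let G_D k u : (G (delta_mx 0 k) (0, u)).2 = sysD alpha k u.
Proof.
have /(congr1 snd)/= -> := G_flow (delta_mx 0 k) 0 u.
by rewrite pencil_delta/= linear0 add0r.
Qed.

Let pencil_sysG z x u : pencil z (sysG alpha) (x, u) =
  (pencil z (sysA alpha) x + pencil z (sysB alpha) u,
   pencil z (sysC alpha) x + pencil z (sysD alpha) u).
Proof.
rewrite /pencil; elim: (index_enum _) => [|k r IHr].
  by rewrite !big_nil !addr0.
by rewrite !big_cons IHr; congr (_, _); rewrite /= scalerDr addrACA.
Qed.

Let G_iota z x u : (G z ((0, x, 0), u)).1.1.2 =
  pencil z (sysA alpha) x + pencil z (sysB alpha) u.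
Proof. by have /(congr1 fst) := G_flow z x u; rewrite pencil_sysG. Qed.

Let G_out z x u : (G z ((0, x, 0), u)).2 =
  pencil z (sysC alpha) x + pencil z (sysD alpha) u.
Proof. by have /(congr1 snd) := G_flow z x u; rewrite pencil_sysG. Qed.

Let pencil0 (V W : sepHilbertType R) z (T : 'I_n.+1 -> {bounded V -> W}) :
  pencil z T 0 = 0.
Proof. by rewrite /pencil big1// => k _; rewrite linear0 scaler0. Qed.

Let blin_A z : blin (fun x => (G z (x, 0)).1).
Proof.
by apply/blin_fst/(blin_comp (blin_G z))/blin_pair; [exact: blin_id|exact: blin_cst0].
Qed.
Let blin_C z : blin (fun x => (G z (x, 0)).2).
Proof.
by apply/blin_snd/(blin_comp (blin_G z))/blin_pair; [exact: blin_id|exact: blin_cst0].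
Qed.
Let blin_B z : blin (fun u => (G z (0, u)).1).
Proof.
by apply/blin_fst/(blin_comp (blin_G z))/blin_pair; [exact: blin_cst0|exact: blin_id].
Qed.

(** The k-th operator of a pencil linear in z is its value at the k-th unit
    vector. *)
Definition dilation_system : system n.+1 Xt U Y := System
  (fun k => to_bounded (blin_A (delta_mx 0 k)))
  (fun k => to_bounded (blin_B (delta_mx 0 k)))
  (fun k => to_bounded (blin_C (delta_mx 0 k)))
  (sysD alpha).

Let pencil_A z : pencil z (sysA dilation_system) = fun x => (G z (x, 0)).1.
Proof.
by apply: (pencil_linear_family (g := fun z x => (G z (x, 0)).1)) => // *;
  rewrite G_lin.
Qed.
Let pencil_B z : pencil z (sysB dilation_system) = fun u => (G z (0, u)).1.
Proof.
by apply: (pencil_linear_family (g := fun z u => (G z (0, u)).1)) => // *;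
  rewrite G_lin.
Qed.
Let pencil_C z : pencil z (sysC dilation_system) = fun x => (G z (x, 0)).2.
Proof.
by apply: (pencil_linear_family (g := fun z x => (G z (x, 0)).2)) => // *;
  rewrite G_lin.
Qed.

Let pencil_G z : pencil z (sysG dilation_system) = G z.
Proof.
apply: (pencil_linear_family (g := G)) => [a w v u|k [x u]]; first exact: G_lin.
have xuE : (x, u) = (x, 0) + (0, u) :> dilation_in X U Y F.
  by congr (_, _); rewrite ?addr0 ?add0r.
rewrite [in RHS]xuE (blinD _ _ (blin_G _)).
rewrite -[LHS]/((G (delta_mx 0 k) (x, 0)).1 + (G (delta_mx 0 k) (0, u)).1,
  (G (delta_mx 0 k) (x, 0)).2 + sysD alpha k u) -G_D.
by move: (G _ (x, 0)) (G _ (0, u)).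
Qed.

Let iota (x : X) : Xt := ((0, x), 0).
Let blin_iota : blin iota.
Proof.
by apply: blin_pair; [apply: blin_pair; [exact: blin_cst0|exact: blin_id]|exact: blin_cst0].
Qed.

Let hdot_iota (v : Xt) m : hdot v (iota m) = hdot v.1.2 m.
Proof.
rewrite /iota hdot_hsumE; cbn [fst snd]; rewrite hdot0r addr0.
by rewrite hdot_hsumE; cbn [fst snd]; rewrite hdot0r add0r.
Qed.

Lemma dilation_system_conservative :
  J_conservative (to_bounded (@blin_Jt R X U Y F)) dilation_system.
Proof.
move=> z z1 /=; rewrite pencil_G.
apply: krein_unitary_hadj.
- by move=> [x u]; rewrite /hsum_op/=; congr (_, _); exact: JtK.
- by move=> [x u]; rewrite /hsum_op/=; congr (_, _); exact: JtK.
apply: (colligation_unitary GammaB DeltaB (z1 _)).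
  by move=> f g; exact: slot_mul_dot.
by move=> g; exact: slot_mul_surj.
Qed.

Lemma dilation_system_dilates : is_dilation dilation_system alpha.
Proof.
exists (to_bounded blin_iota); split; [by move=> x y; exact: hdot_iota|by []|].
move=> z; cbn zeta; rewrite pencil_A pencil_B pencil_C.
pose M (w : Xt) : hsum X (future X Y F) := (w.1.2, w.2).
have bid := blin_id Xt.
have bM : blin M by apply: blin_pair; [exact/blin_snd/blin_fst|exact: blin_snd].
(* The kernel of M is the past D; the kernel of fst is the future D_*. *)
have pastE (w : Xt) : M w = 0 -> exists d, w = (d, 0, 0).
  case: w => -[d x] s Mw; exists d.
  by have [-> ->] : x = 0 /\ s = 0; first exact: (conj (congr1 fst Mw) (congr1 snd Mw)).
have Gfuture x u (s : future X Y F) :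
    hdot (G z (x, u)).1 ((0, s) : Xt) = z 0 ord0 * hdot (ell2_behead x.2) s.
  by rewrite hdot_hsumE hdot0r add0r -hdotZl.
have projE (v : Xt) (x : X) : v.1.2 = x -> iota x = hproj (range (to_bounded blin_iota)) v.
  move=> vx; symmetry; apply: (hproj_eq blin_iota) => m.
  by rewrite hdotBl !hdot_iota vx subrr.
exists [set w | M w = 0], [set w : Xt | w.1 = 0]; split.
- by split; apply: closed_subspace_ker => //; exact: blin_fst.
- split.
  + move=> u v /pastE[d ->] [y _ <-].
    by apply: (etrans (hdot_iota _ _)); exact: hdot0l.
  + move=> u [v t] /pastE[d ->] /= ->.
    by rewrite hdot_hsumE/= hdot0r hdot0l addr0.
  + move=> u v [x _ <-] v0; rewrite dotC.
    have -> : hdot v (to_bounded blin_iota x) = 0; last by rewrite rmorph0.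
    by apply: (etrans (hdot_iota _ _)); rewrite v0 hdot0l.
  + move=> [[d x] s]; exists (d, 0, 0), (iota x), (0, s).
    split; [by []|by exists x|by []|].
    by congr (_, _); [congr (_, _)|]; rewrite /= ?addr0 ?add0r.
- have past d : G z ((d, 0, 0), 0) = (((ell2_cons 0 (z 0 ord0 *: d), 0), 0), 0).
    by rewrite /G (colligation_past GammaB DeltaB)//; exact: blin_slot_mul.
  split; first by move=> _ [w /pastE[d ->] <-]; rewrite past.
  apply/seteqP; split => [_ [w /pastE[d ->] <-]|_ ->]; first by rewrite past.
  by exists ((0, 0, 0) : Xt) => //; rewrite past.
- split.
    (* test the adjoint against its own component outside of the future *)
    move=> _ [[v s] /= -> <-]; set w := hadj _ _; apply/eqP.
    rewrite -(dnorm_eq0 (@hdot R _)).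
    have : hdot ((w.1, 0) : Xt) w = 0.
      rewrite -(hadjP _ _ (blin_A z)) Gfuture; cbn [fst snd].
      by rewrite (blin0 (blin_behead _)) hdot0l mulr0.
    by rewrite hdot_hsumE/= hdot0l addr0 => ->.
  have B0 s : hadj (fun u => (G z (0, u)).1) ((0, s) : Xt) = 0.
    apply: hadj_eq => u; rewrite Gfuture; cbn [fst snd].
    by rewrite (blin0 (blin_behead _)) hdot0l mulr0 hdot0r.
  apply/seteqP; split => [_ [[v s] /= -> <-]|_ ->]; first exact: B0.
  by exists 0 => //; exact: B0.
- split=> [x|u|x].
  + by apply: projE; rewrite G_iota pencil0 addr0.
  + by apply: projE; rewrite (G_iota z 0) pencil0 add0r.
  + by rewrite G_out pencil0 addr0.
Qed.

End Dilation.

Theorem theorem2p3 (R : realType) (N : nat) (hN : (0 < N)%N)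
    (X U Y : sepHilbertType R) (alpha : system N X U Y) :
  exists (Xt : sepHilbertType R) (alphat : system N Xt U Y)
    (J : {bounded Xt -> Xt}),
    canonical_symmetry J /\ is_dilation alphat alpha /\ J_conservative J alphat.
Proof.
case: N hN alpha => // n _ alpha.
exists (dilation_space X U Y (ell2 (outflow X Y))), (dilation_system alpha).
exists (to_bounded (@blin_Jt R X U Y _)); split; last first.
  by split; [exact: dilation_system_dilates|exact: dilation_system_conservative].
split; last by apply/funext; exact: JtK.
by apply/funext => y; apply: hadj_eq => x; exact: Jt_adj.
Qed.
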